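(* Let $m,n\ge 1$ be integers. For $A \in M_{m\times n}(\mathbb{R})$, $\mathbf{w}\in\mathbb{R}^m$, $b>0$ and $T>1$, let $$N(A,\mathbf{w},b,T) := \#\left\{(\mathbf{p},\mathbf{q}) \in \mathbb{Z}^m\times\mathbb{Z}^n : \|A\mathbf{q} - \mathbf{p}-\mathbf{w}\| \le b\|\mathbf{q}\|^{-n/m},\ 1 \le \|\mathbf{q}\| < T\right\}.$$ Then for each $b>0$ and for almost every $(A,\mathbf{w}) \in M_{m\times n}(\mathbb{R})\times\mathbb{R}^m$ (with respect to Lebesgue measure), $$\lim_{T\to\infty} \frac{N(A,\mathbf{w},b,T)}{b^m B_m C_n \log T} = 1.$$
   Context: $M_{m\times n}(\mathbb{R})$ is the space of real $m\times n$ matrices. $\|\cdot\|$ denotes the Euclidean norm (on $\mathbb{R}^m$ and on $\mathbb{R}^n$). $B_k$ denotes the volume of the Euclidean unit ball in $\mathbb{R}^k$, and $C_k$ denotes the surface area of the unit sphere $\mathbb{S}^{k-1}\subset\mathbb{R}^k$ (e.g. $C_1=2$, $C_2=2\pi$, $C_3=4\pi$). *)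

(* Defs.v *)
From HB Require Import structures.
From mathcomp Require Import all_boot all_order all_algebra.
From mathcomp Require Import all_classical all_reals all_analysis.

Set Implicit Arguments.
Unset Strict Implicit.
Unset Printing Implicit Defensive.

Import Order.TTheory GRing.Theory Num.Theory.
Import numFieldNormedType.Exports.

Local Open Scope classical_set_scope.
Local Open Scope ring_scope.

(* The sigma-algebra on 'M[T]_(m, n) is the one generated by the entries
   (listed through [mxvec]); for T = R it is the Borel sigma-algebra. *)
Definition measure_mx_display : measure_display -> measure_display.
Proof. exact. Qed.

Section measurable_matrix.
Context {d : measure_display} {T : measurableType d} (m n : nat).

Let entry (k : 'I_(m * n)) (A : 'M[T]_(m, n)) : T := mxvec A 0 k.

Let mx_set0 : g_sigma_preimage entry set0.
Proof. exact: sigma_algebra0. Qed.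

Let mx_setC A : g_sigma_preimage entry A -> g_sigma_preimage entry (~` A).
Proof. exact: sigma_algebraC. Qed.

Let mx_bigcup (F : (set 'M[T]_(m, n))^nat) :
  (forall i, g_sigma_preimage entry (F i)) ->
  g_sigma_preimage entry (\bigcup_i F i).
Proof. exact: sigma_algebra_bigcup. Qed.

HB.instance Definition _ := @isMeasurable.Build (measure_mx_display d)
  'M[T]_(m, n) (g_sigma_preimage entry) mx_set0 mx_setC mx_bigcup.

Definition mx_of_tuple (t : (m * n).-tuple T) : 'M[T]_(m, n) :=
  vec_mx (\row_k tnth t k).

Definition tuple_of_mx (A : 'M[T]_(m, n)) : (m * n).-tuple T :=
  [tuple mxvec A 0 k | k < m * n].

Lemma mx_of_tupleK : cancel mx_of_tuple tuple_of_mx.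
Proof.
move=> t; apply: eq_from_tnth => k.
by rewrite tnth_mktuple /mx_of_tuple vec_mxK mxE.
Qed.

Lemma measurable_mx_of_tuple : measurable_fun setT mx_of_tuple.
Proof.
move=> _ A mA; rewrite setTI.
suff -> : @measurable _ ((m * n).-tuple T) =
    preimage_set_system setT mx_of_tuple (@measurable _ 'M[T]_(m, n)).
  by exists A => //; rewrite setTI.
rewrite /measurable/= -g_sigma_preimage_comp.
congr g_sigma_preimage; apply/funext => k; apply/funext => t /=.
by rewrite /entry /mx_of_tuple vec_mxK mxE.
Qed.

Lemma measurable_tuple_of_mx : measurable_fun setT tuple_of_mx.
Proof.
apply/measurable_fun_tnthP => k _ A mA; rewrite setTI.
apply: sub_sigma_algebra => /=.
rewrite -bigcup_seq/=; exists k => /=; first by rewrite mem_index_enum.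
exists A => //; rewrite setTI; apply/funext => M /=.
by rewrite /preimage/= tnth_mktuple.
Qed.

End measurable_matrix.

Lemma sigma_finite_product d1 d2 (T1 : measurableType d1)
    (T2 : measurableType d2) (R : realType)
    (m1 : {sigma_finite_measure set T1 -> \bar R})
    (m2 : {sigma_finite_measure set T2 -> \bar R}) :
  sigma_finite setT (m1 \x m2)%E.
Proof.
have /sigma_finiteP[F [TF ndF Foo]] := sigma_finiteT m1.
have /sigma_finiteP[G [TG ndG Goo]] := sigma_finiteT m2.
exists (fun n => F n `*` G n).
  rewrite -setXTT TF TG predeqE => -[x y]; split.
    move=> [/= [n _ Fnx] [k _ Gky]]; exists (maxn n k) => //; split.
    - by move: x Fnx; exact/subsetPset/ndF/leq_maxl.
    - by move: y Gky; exact/subsetPset/ndG/leq_maxr.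
  by move=> [n _ []/= ? ?]; split; exists n.
move=> k; have [? ?] := Foo k; have [? ?] := Goo k.
split; first exact: measurableX.
by rewrite product_measure1E// lte_mul_pinfty// ge0_fin_numE.
Qed.

Section sigma_finite_pushforward.
Context {d1 d2 : measure_display} {T1 : measurableType d1}
  {T2 : measurableType d2} {R : realType}.
Variables (mu : {measure set T1 -> \bar R}).
Hypothesis sigma_finite_mu : sigma_finite setT mu.
Variables (f : T1 -> T2) (g : T2 -> T1).
Hypotheses (mf : measurable_fun setT f) (mg : measurable_fun setT g).
Hypothesis fK : cancel f g.

Let sigma_finite_pushforward : sigma_finite setT (pushforward mu f).
Proof.
have [F TF Foo] := sigma_finite_mu; exists (fun i => g @^-1` F i).
  by rewrite -preimage_bigcup -TF preimage_setT.
move=> i; have [mF Fi] := Foo i; split.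
  by rewrite -[X in measurable X]setTI; exact: mg.
rewrite /pushforward -comp_preimage (_ : g \o f = id)//.
by apply/funext => x /=; rewrite fK.
Qed.

Let nu := pushforward mu f.

Let nu_measure : {measure set T2 -> \bar R} :=
  measure_function_pushforward__canonical__measure_function_Measure mu mf.

#[local]
HB.instance Definition _ := isMeasure.Build _ _ _ nu
  (measure0 nu_measure) (measure_ge0 nu_measure)
  (@measure_semi_sigma_additive _ _ _ nu_measure).

#[local]
HB.instance Definition _ := Measure_isSigmaFinite.Build _ _ _ nu
  sigma_finite_pushforward.

Definition pushforward_sigma_finite : {sigma_finite_measure set T2 -> \bar R} :=
  nu.

End sigma_finite_pushforward.

Section lebesgue_tuple.
Context {R : realType}.

Definition tuple_cons k (x : measurableTypeR R * k.-tuple R) : k.+1.-tuple R :=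
  [tuple of (x.1 : R) :: x.2].

Definition tuple_uncons k (t : k.+1.-tuple R) : measurableTypeR R * k.-tuple R :=
  (thead t, [tuple of behead t]).

Lemma tuple_consK k : cancel (@tuple_cons k) (@tuple_uncons k).
Proof.
move=> [x t]; rewrite /tuple_uncons/tuple_cons/= theadE; congr pair.
exact: val_inj.
Qed.

Lemma measurable_tuple_cons k : measurable_fun setT (@tuple_cons k).
Proof. by apply: measurable_cons. Qed.

Lemma measurable_tuple_uncons k : measurable_fun setT (@tuple_uncons k).
Proof.
apply/measurable_fun_pairP; split; first exact: measurable_tnth.
exact: measurable_behead.
Qed.

Fixpoint lebesgue_tuple (k : nat) :
    {sigma_finite_measure set (k.-tuple R) -> \bar R} :=
  match k with
  | 0 => \d_([tuple])
  | j.+1 => pushforward_sigma_finite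
      (sigma_finite_product lebesgue_measure (lebesgue_tuple j))
      (@measurable_tuple_cons j) (@measurable_tuple_uncons j) (@tuple_consK j)
  end.

Lemma lebesgue_tupleS k :
  lebesgue_tuple k.+1 =
  pushforward (lebesgue_measure \x lebesgue_tuple k)%E (@tuple_cons k)
    :> (set _ -> _).
Proof. by []. Qed.

Lemma lebesgue_tuple_box k (X : 'I_k -> set R) :
  (forall i, measurable (X i)) ->
  lebesgue_tuple k [set t | forall i, X i (tnth t i)] =
  (\prod_(i < k) lebesgue_measure (X i))%E.
Proof.
elim: k X => [|k IH] X mX.
  by rewrite /= big_ord0 diracE mem_set//= => -[m].
rewrite big_ord_recl lebesgue_tupleS /pushforward.
have -> : @tuple_cons k @^-1` [set t | forall i, X i (tnth t i)] =
    X ord0 `*` [set t | forall i, X (lift ord0 i) (tnth t i)].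
  apply/seteqP; split => -[x t] /= => [h|[h0 h] i].
    split=> [|i]; first exact: (h ord0).
    by have := h (lift ord0 i); rewrite tnthS.
  by case: (unliftP ord0 i) => [j ->|->]; rewrite ?tnthS//; exact: h.
rewrite product_measure1E//.
- by rewrite -(IH (fun i => X (lift ord0 i))).
- exact: mX.
- rewrite (_ : [set _ | _] =
    \bigcap_(i in [set: 'I_k]) ((@tnth _ R)^~ i @^-1` X (lift ord0 i))).
    apply: fin_bigcap_measurable => // i _.
    by rewrite -[X in measurable X]setTI; apply: measurable_tnth.
  by apply/seteqP; split => t /= h i; [move=> _|]; exact: h.
Qed.

End lebesgue_tuple.

Section lebesgue_mx.
Context {R : realType}.

(* Lebesgue measure on the space of m x n matrices, i.e. on R^(m * n) *)
Definition lebesgue_mx (m n : nat) :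
    {sigma_finite_measure set 'M[R]_(m, n) -> \bar R} :=
  pushforward_sigma_finite (sigma_finiteT (lebesgue_tuple (m * n)))
    (@measurable_mx_of_tuple _ R m n) (@measurable_tuple_of_mx _ R m n)
    (@mx_of_tupleK _ R m n).

Lemma lebesgue_mxE m n (A : set 'M[R]_(m, n)) :
  lebesgue_mx m n A = lebesgue_tuple (m * n) (@mx_of_tuple _ _ m n @^-1` A).
Proof. by []. Qed.

Lemma lebesgue_mx_box m n (X : 'I_m -> 'I_n -> set R) :
  (forall i j, measurable (X i j)) ->
  lebesgue_mx m n [set A | forall i j, X i j (A i j)] =
  (\prod_(i < m) \prod_(j < n) lebesgue_measure (X i j))%E.
Proof.
move=> mX; rewrite pair_bigA.
pose kij k := enum_val (cast_ord (esym (mxvec_cast m n)) k).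
have kijE i j : kij (mxvec_index i j) = (i, j).
  by rewrite /kij cast_ordK enum_rankK.
pose Y (k : 'I_(m * n)) := X (kij k).1 (kij k).2.
transitivity (\prod_k lebesgue_measure (Y k))%E; last first.
  rewrite (reindex _ (curry_mxvec_bij m n)) /=.
  by apply: eq_bigr => -[i j] _ /=; rewrite /Y kijE.
rewrite -lebesgue_tuple_box; last by move=> k; exact: mX.
rewrite lebesgue_mxE; congr (lebesgue_tuple _ _).
apply/seteqP; split => t /= h => [k|i j].
  case/mxvec_indexP: k => i j; rewrite /Y kijE.
  by have := h i j; rewrite !mxE.
by have := h (mxvec_index i j); rewrite /Y kijE !mxE.
Qed.

(* The norm `|v| of the library is the sup norm. *)
Definition enorm {k : nat} (v : 'cV[R]_k) : R :=
  Num.sqrt (\sum_i v i 0 ^+ 2).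

Definition unit_ball_volume (k : nat) : R :=
  fine (lebesgue_mx k 1 [set x | enorm x <= 1]).

(* Surface area of a hypersurface S of R^k, as its Minkowski content: the limit
   of vol {x | d(x, S) < e} / (2 e) as e goes to 0. *)
Definition surface_area (k : nat) (S : set 'cV[R]_k) : R :=
  lim ((fine (lebesgue_mx k 1 [set x | exists2 y, S y & enorm (x - y) < e])
        / (2 * e)) @[e --> 0^'+]).

Definition unit_sphere_area (k : nat) : R :=
  surface_area [set x : 'cV[R]_k | enorm x = 1].

Definition num_solutions (m n : nat) (A : 'M[R]_(m, n)) (w : 'cV[R]_m) (b T : R) :
    \bar R :=
  counting [set pq : 'cV[int]_m * 'cV[int]_n |
    let p := map_mx intr pq.1 in let q := map_mx intr pq.2 in
    enorm (A *m q - p - w) <= b * enorm q `^ (- (n%:R / m%:R)) /\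
    1 <= enorm q < T].

End lebesgue_mx.

Arguments lebesgue_tuple : simpl never.
Arguments lebesgue_mx : simpl never.

(* Main.v *)
Require Import Defs.
From HB Require Import structures.
From mathcomp Require Import all_boot all_order all_algebra.
From mathcomp Require Import all_classical all_reals all_analysis.
From mathcomp Require Import measurable_realfun ring lra zify.

(** Fix integer vectors [q], and let [E q] be the set of pairs [(A, w)] for which
[w - A q] lies within [r_q = b |q| ^ (- n / m)] of an integer vector.  Once
[r_q < 1/2] the nearby integer vector is unique, so up to a bounded term the
number of solutions with [|q| < T] is the number of the events [E q], [|q| < T],
to which [(A, w)] belongs ([solutions_count_cat]).

Everything is periodic under integer translations, so it is enough to work on
unit cells, which are probability spaces.  There [E q] has probability
[v_q = r_q ^ m B_m = b ^ m B_m |q| ^ (- n)] ([mu_hit], [vol_near_lattice]), and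
two events [E q], [E q'] with [q <> q'] are independent: for fixed [A], the
translation of [w] by [A q] turns the two conditions into conditions on [w] and
on [w - A (q' - q)], and for fixed [w] the second vector is equidistributed on
the torus when [A] varies, because [q' - q <> 0] ([mu_hit2]).  The inhomogeneous
term [w] is what makes all pairs independent, including [q] and [2 q].

Hence the variance of the number of events up to [T] is at most its mean
[V_T], the sum of the [v_q].  Chebyshev's inequality along [T_j = exp (j ^ 2)],
where [V_(T_j)] has order [j ^ 2], shows that almost surely the count divided by
[V_T] tends to 1 along that sequence ([slln_along]).  Since the count is
monotone and [ln T_(j+1) / ln T_j] tends to 1, the convergence extends to all [T]
([cvg_log_interpolation]).

There remains the asymptotics of [V_T], that is
[\sum_(1 <= |q| < T) |q| ^ (- n) ~ n B_n ln T] ([lattice_sum_asymptotic]).  It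
comes from the count of integer points of a ball, by volume comparison, in
shells between the radii [(k + 1) ^ 2].  Finally [n B_n] is the area of the unit
sphere ([unit_sphere_areaE]): the sphere being thickened into a difference of two
balls, its Minkowski content is the derivative of [r ^ n B_n] at [r = 1]. *)

Set Implicit Arguments.
Unset Strict Implicit.
Unset Printing Implicit Defensive.

Import Order.TTheory GRing.Theory Num.Theory.
Import numFieldNormedType.Exports.

Local Open Scope classical_set_scope.
Local Open Scope ring_scope.

(** * Limits of real functions and sequences *)

Section real_asymptotics.
Context {R : realType}.

Lemma cvg_exprn (T : Type) (F : set_system T) {FF : Filter F} (f : T -> R) (a : R) k :
  f t @[t --> F] --> a -> f t ^+ k @[t --> F] --> a ^+ k.
Proof.
move=> fa; apply: (@continuous_cvg _ _ _ _ _ _ (fun x : R => x ^+ k)) => //.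
exact: exprn_continuous.
Qed.

(** The sum is the cofactor of [x - y] in [x ^+ k - y ^+ k]: this is the derivative
at 1 of the [k]-th power, with two moving end points. *)
Lemma cvg_subrXX_factor (T : Type) (F : set_system T) (x y : T -> R) k : Filter F ->
  x t @[t --> F] --> (1 : R) -> y t @[t --> F] --> (1 : R) ->
  \sum_(i < k) x t ^+ (k.-1 - i) * y t ^+ i @[t --> F] --> (k%:R : R).
Proof.
move=> FF x1 y1; rewrite -[k in k%:R]card_ord -sumr_const.
apply: cvg_big => // [|i _]; first exact: add_continuous.
suff : x t ^+ (k.-1 - i) * y t ^+ i @[t --> F] --> (1 : R) ^+ (k.-1 - i) * 1 ^+ i.
  by rewrite !expr1n mulr1.
by apply: cvgM; exact: cvg_exprn.
Qed.

(** Weighted Cesaro means.  From some rank [N] on, [a k] is within [e / 2 * b k]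
of [l * b k]; the errors before [N] add up to a constant [M], which is negligible
as the total weight diverges. *)
Lemma stolz_cesaro (a b : nat -> R) (l : R) : (forall k, 0 < b k) ->
    \sum_(k < K) b k @[K --> \oo] --> +oo ->
    a k / b k @[k --> \oo] --> l ->
  (\sum_(k < K) a k) / (\sum_(k < K) b k) @[K --> \oo] --> l.
Proof.
move=> b0 By abl; apply/cvgrPdist_le => e e0.
have e20 : 0 < e / 2 by rewrite divr_gt0.
have [N _ Nl] : \forall k \near \oo, `|l - a k / b k| <= e / 2.
  by move/cvgrPdist_le: abl; exact.
pose M := \sum_(k < N) `|l * b k - a k|.
have dk k : (N <= k)%N -> `|l * b k - a k| <= e / 2 * b k.
  move=> /Nl /= h; have -> : l * b k - a k = (l - a k / b k) * b k.
    by field; rewrite gt_eqF.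
  by rewrite normrM (gtr0_norm (b0 k)) ler_pM2r.
have bound K : (N <= K)%N ->
    \sum_(k < K) `|l * b k - a k| <= M + e / 2 * \sum_(k < K) b k.
  elim: K => [|K IH]; first by rewrite leqn0 => /eqP N0; rewrite /M N0 !big_ord0 mulr0 addr0.
  rewrite leq_eqVlt => /predU1P[<-|]; first by rewrite lerDl mulr_ge0 ?(ltW e20)//;
    rewrite sumr_ge0// => k _; exact: ltW.
  rewrite ltnS => NK; rewrite !big_ord_recr/= mulrDr addrA lerD ?IH ?dk//.
near=> K.
have NK : (N <= K)%N by near: K; exact: nbhs_infty_ge.
have BM : M / (e / 2) + 1 <= \sum_(k < K) b k.
  by near: K; move/cvgryPge: By; exact.
have M0 : 0 <= M by exact: sumr_ge0.
have B0 : 0 < \sum_(k < K) b k.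
  by apply: lt_le_trans BM; rewrite ltr_wpDl// divr_ge0// ltW.
have -> : l - (\sum_(k < K) a k) / (\sum_(k < K) b k) =
    (\sum_(k < K) (l * b k - a k)) / \sum_(k < K) b k.
  by rewrite sumrB -mulr_sumr mulrBl mulfK ?gt_eqF.
rewrite normrM normfV (gtr0_norm B0) ler_pdivrMr//.
apply: le_trans (ler_norm_sum _ _ _) _; apply: le_trans (bound _ NK) _.
have : M <= e / 2 * \sum_(k < K) b k.
  by rewrite mulrC -ler_pdivrMr//; apply: le_trans BM; rewrite lerDl.
lra.
Unshelve. all: by end_near. Qed.

(** Convergence along a sequence whose logarithms grow subexponentially passes
    to the continuous parameter, by squeezing between consecutive terms. *)
Lemma cvg_log_interpolation (f : R -> R) (t : nat -> R) (c : R) :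
    (forall x y, x <= y -> f x <= f y) -> (forall x, 0 <= f x) ->
    {homo t : i j / (i <= j)%N >-> i <= j} -> (forall k, 1 < t k) ->
    t k @[k --> \oo] --> +oo ->
    ln (t k.+1) / ln (t k) @[k --> \oo] --> (1 : R) ->
    f (t k) / ln (t k) @[k --> \oo] --> c ->
  f T / ln T @[T --> +oo] --> c.
Proof.
move=> ndf f0 ndt t1 ty rt ft.
have l0 k : 0 < ln (t k) by rewrite ln_gt0.
have lo : f (t k) / ln (t k.+1) @[k --> \oo] --> c.
  rewrite -[c]mulr1 -invr1.
  under eq_fun => k.
    rewrite (_ : f (t k) / ln (t k.+1) = (f (t k) / ln (t k)) * (ln (t k.+1) / ln (t k))^-1).
      over.
    by field; rewrite !gt_eqF.
  by apply: cvgM => //; apply: cvgV => //; exact: oner_neq0.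
have hi : f (t k.+1) / ln (t k) @[k --> \oo] --> c.
  rewrite -[c]mulr1.
  under eq_fun => k.
    rewrite (_ : f (t k.+1) / ln (t k) = (f (t k.+1) / ln (t k.+1)) * (ln (t k.+1) / ln (t k))).
      over.
    by field; rewrite !gt_eqF.
  apply: cvgM => //; move: ft; rewrite -(cvg_shiftS (fun k => f (t k) / ln (t k))); exact.
apply/cvgrPdist_le => e e0.
have [N1 _ lo1] : \forall k \near \oo, `|c - f (t k) / ln (t k.+1)| <= e.
  by move/cvgrPdist_le: lo; exact.
have [N2 _ hi2] : \forall k \near \oo, `|c - f (t k.+1) / ln (t k)| <= e.
  by move/cvgrPdist_le: hi; exact.
pose N := maxn N1 N2.
near=> T.
have tN : t N <= T by near: T; apply: nbhs_pinfty_ge; exact: num_real.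
have exk : exists k, T < t k.
  have [K _ HK] : \forall k \near \oo, T + 1 <= t k by move/cvgryPge: ty; exact.
  by exists K; apply: lt_le_trans (HK K (leqnn K)); rewrite ltrDl.
(* the first term above [T], so that the previous one is at most [T] *)
pose j := ex_minn exk; have [Tj jmin] : T < t j /\ forall i, T < t i -> (j <= i)%N.
  by rewrite /j; case: ex_minnP.
have Nj : (N < j)%N by rewrite ltnNge; apply: contraL Tj => /ndt jN; rewrite -leNgt (le_trans jN).
have [k jk] : exists k, j = k.+1 by exists j.-1; rewrite prednK// (leq_ltn_trans _ Nj).
have kT : t k <= T by rewrite leNgt; apply/negP => /jmin; rewrite jk ltnn.
rewrite jk in Tj Nj.
have T1 : 1 < T by exact: lt_le_trans kT.
have lT : 0 < ln T by rewrite ln_gt0.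
have tp i : t i \is Num.pos by rewrite posrE (lt_trans ltr01).
have Tp : T \is Num.pos by rewrite posrE (lt_trans ltr01).
have lkT : ln (t k) <= ln T by rewrite ler_ln.
have lTk : ln T <= ln (t k.+1) by rewrite ler_ln// ltW.
move: Nj; rewrite ltnS geq_max => /andP[/lo1/ler_normlP[h1 h2] /hi2/ler_normlP[h3 h4]].
have L : f (t k) / ln (t k.+1) <= f T / ln T.
  by apply: ler_pM; rewrite ?invr_ge0 ?(ltW (l0 _)) ?ndf// lef_pV2 ?posrE.
have U : f T / ln T <= f (t k.+1) / ln (t k).
  by apply: ler_pM; rewrite ?invr_ge0 ?(ltW lT) ?ndf ?(ltW Tj)// lef_pV2 ?posrE.
by apply/ler_normlP; split; lra.
Unshelve. all: by end_near. Qed.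

(** Comparison with the telescoping series of the [2 c / (j + 1) - 2 c / (j + 2)]. *)
Lemma nneseries_inv_sqr (c : R) : 0 <= c ->
  (\sum_(0 <= j <oo) (c / j.+1%:R ^+ 2)%:E < +oo)%E.
Proof.
move=> c0; apply: (@le_lt_trans _ _ (c * 2)%:E); last exact: ltry.
apply: lime_le.
  by apply: is_cvg_nneseries => j _ _; rewrite lee_fin divr_ge0// exprn_ge0.
near=> N; rewrite sumEFin lee_fin -mulr_sumr ler_wpM2l//.
pose g k : R := - (2 / k.+1%:R).
apply: (@le_trans _ _ (\sum_(0 <= j < N) (g j.+1 - g j))).
  apply: ler_sum => j _; rewrite /g -[j.+2%:R]natr1.
  have j0 : 0 < j.+1%:R :> R by [].
  have j1 : 1 <= j.+1%:R :> R by rewrite ler1n.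
  set x : R := j.+1%:R in j0 j1 *.
  have x10 : 0 < x + 1 by rewrite ltr_pwDr.
  rewrite -subr_ge0.
  have -> : - (2 / (x + 1)) - - (2 / x) - (x ^+ 2)^-1 = (x - 1) / (x ^+ 2 * (x + 1)).
    by field; rewrite !gt_eqF.
  by rewrite divr_ge0 ?subr_ge0// mulr_ge0 ?exprn_ge0 ?ltW.
rewrite telescope_sumr// /g opprK divr1 gerDr oppr_le0; exact: divr_ge0.
Unshelve. all: by end_near. Qed.

End real_asymptotics.

(** * The Euclidean norm *)

Section enorm_theory.
Context {R : realType} {k : nat}.
Implicit Types (u v : 'cV[R]_k) (c : R).

Lemma sumsq_ge0 v : 0 <= \sum_i v i 0 ^+ 2.
Proof. by apply: sumr_ge0 => i _; exact: sqr_ge0. Qed.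

Lemma enorm_ge0 v : 0 <= enorm v.
Proof. exact: sqrtr_ge0. Qed.

Lemma enorm_sqr v : enorm v ^+ 2 = \sum_i v i 0 ^+ 2.
Proof. by rewrite sqr_sqrtr ?sumsq_ge0. Qed.

Lemma enorm_le v c : 0 <= c -> (enorm v <= c) = (\sum_i v i 0 ^+ 2 <= c ^+ 2).
Proof. by move=> c0; rewrite -enorm_sqr ler_pXn2r// nnegrE ?enorm_ge0. Qed.

Lemma enormZ c v : enorm (c *: v) = `|c| * enorm v.
Proof.
rewrite /enorm -sqrtr_sqr -sqrtrM ?sqr_ge0//; congr Num.sqrt.
by rewrite mulr_sumr; apply: eq_bigr => i _; rewrite mxE exprMn.
Qed.

Lemma enormN v : enorm (- v) = enorm v.
Proof. by rewrite -scaleN1r enormZ normrN1 mul1r. Qed.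

Lemma le_entry_enorm v i : `|v i 0| <= enorm v.
Proof.
rewrite -sqrtr_sqr /enorm ler_wsqrtr// (bigD1 i)//= lerDl.
by apply: sumr_ge0 => j _; exact: sqr_ge0.
Qed.

(** The Cauchy-Schwarz inequality, read off from Lagrange's identity
    [2 |u|^2 |v|^2 - 2 (u.v)^2 = \sum_(i, j) (u_i v_j - u_j v_i)^2]. *)
Lemma dot_le_enorm u v : \sum_i u i 0 * v i 0 <= enorm u * enorm v.
Proof.
apply: le_trans (ler_norm _) _.
rewrite -ler_sqr ?nnegrE ?mulr_ge0 ?enorm_ge0// real_normK ?num_real//.
rewrite exprMn !enorm_sqr.
have : 0 <= \sum_i \sum_j (u i 0 * v j 0 - u j 0 * v i 0) ^+ 2.
  by apply: sumr_ge0 => i _; apply: sumr_ge0 => j _; exact: sqr_ge0.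
have -> : \sum_i \sum_j (u i 0 * v j 0 - u j 0 * v i 0) ^+ 2 =
    2 * ((\sum_i u i 0 ^+ 2) * \sum_i v i 0 ^+ 2 - (\sum_i u i 0 * v i 0) ^+ 2).
  transitivity (\sum_i \sum_j (u i 0 ^+ 2 * v j 0 ^+ 2) +
      \sum_i \sum_j (v i 0 ^+ 2 * u j 0 ^+ 2) -
      2 * \sum_i \sum_j ((u i 0 * v i 0) * (u j 0 * v j 0))).
    rewrite mulr_sumr -big_split -sumrB /=; apply: eq_bigr => i _.
    rewrite mulr_sumr -big_split -sumrB /=; apply: eq_bigr => j _; ring.
  have E (f g : 'I_k -> R) : \sum_i \sum_j f i * g j = (\sum_i f i) * \sum_j g j.
    by rewrite mulr_suml; apply: eq_bigr => i _; rewrite mulr_sumr.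
  rewrite (E (fun i => u i 0 ^+ 2) (fun i => v i 0 ^+ 2)).
  rewrite (E (fun i => v i 0 ^+ 2) (fun i => u i 0 ^+ 2)).
  rewrite (E (fun i => u i 0 * v i 0) (fun i => u i 0 * v i 0)); ring.
by rewrite pmulr_rge0// subr_ge0.
Qed.

Lemma enormD u v : enorm (u + v) <= enorm u + enorm v.
Proof.
rewrite enorm_le ?addr_ge0 ?enorm_ge0// sqrrD !enorm_sqr.
have -> : \sum_i (u + v) i 0 ^+ 2 =
    \sum_i u i 0 ^+ 2 + (\sum_i u i 0 * v i 0) *+ 2 + \sum_i v i 0 ^+ 2.
  rewrite -sumrMnl -!big_split /=; apply: eq_bigr => i _; rewrite mxE; ring.
by rewrite lerD2r lerD2l lerMn2r dot_le_enorm.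
Qed.

Lemma enormB u v : enorm (u - v) <= enorm u + enorm v.
Proof. by rewrite -(enormN v) enormD. Qed.

Lemma enorm_le_sqrt v c : 0 <= c -> (forall i, `|v i 0| <= c) ->
  enorm v <= Num.sqrt k%:R * c.
Proof.
move=> c0 vc; rewrite enorm_le ?mulr_ge0 ?sqrtr_ge0// exprMn sqr_sqrtr ?ler0n//.
rewrite mulrC mulr_natr -[k in leRHS]card_ord -sumr_const ler_sum// => i _.
by rewrite -real_normK ?num_real// ler_sqr ?nnegrE.
Qed.

End enorm_theory.

(** * Affine maps and periodic functions in dimension one *)

Section affine1.
Context {R : realType}.
Implicit Types (c v a : R).

Definition affine c v : measurableTypeR R -> measurableTypeR R :=
  fun x => c * x + v.

Lemma measurable_affine c v : measurable_fun setT (affine c v).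
Proof. by apply: measurable_funD => //; apply: measurable_funM. Qed.

Lemma affine_preimage_itvoc c v a b : 0 < c ->
  affine c v @^-1` `]a, b]%classic = `](a - v) / c, (b - v) / c]%classic.
Proof.
move=> c0; apply/seteqP; split => x /=; rewrite /affine !in_itv /= ltr_pdivrMr// ler_pdivlMr//.
  by move=> /andP[h1 h2]; apply/andP; split; rewrite ?ltrBlDr ?lerBrDr mulrC.
by rewrite ltrBlDr lerBrDr ![_ * c]mulrC.
Qed.

(** Lebesgue measure is determined by its values on half-open intervals, and the
preimage of such an interval is again one, shorter by the factor [c]. *)
Lemma lebesgue_measure_affine c v (A : set (measurableTypeR R)) :
    0 < c -> measurable A ->
  (lebesgue_measure (affine c v @^-1` A) = c^-1%:E * lebesgue_measure A)%E.
Proof.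
move=> c0 mA; have cnn : 0 <= c by exact: ltW.
have mf := measurable_affine c v.
pose nu : {measure set _ -> \bar R} :=
  mscale (NngNum cnn) (measure_function_pushforward__canonical__measure_function_Measure
     (@lebesgue_measure R) mf).
have -> : lebesgue_measure A = nu A.
  refine (@lebesgue_measure_unique R nu _ A mA) => X [[a b]] _ <-.
  rewrite /nu /= /mscale /= /pushforward affine_preimage_itvoc//.
  rewrite !lebesgue_measure_itv /= !lte_fin ltr_pM2r ?invr_gt0// ltrD2r.
  case: ifPn => _; last by rewrite mule0.
  by rewrite -!EFinB -EFinM; congr (_%:E); field; rewrite gt_eqF.
by rewrite /nu /= /mscale /= /pushforward muleA -EFinM mulVf ?gt_eqF// mul1e.
Qed.

Lemma ge0_integral_affine c v (D : set (measurableTypeR R)) (f : R -> \bar R) :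
    0 < c -> measurable D -> measurable_fun setT f -> (forall x, 0 <= f x)%E ->
  (\int[lebesgue_measure]_(x in affine c v @^-1` D) f (c * x + v)%R =
   c^-1%:E * \int[lebesgue_measure]_(x in D) f x)%E.
Proof.
move=> c0 mD mf f0.
have c1 : 0 <= c^-1 by rewrite invr_ge0 ltW.
rewrite -(ge0_integral_mscale _ mD (NngNum c1))//; last exact: measurable_funS mf.
rewrite -[LHS](ge0_integral_pushforward (measurable_affine c v))//; last exact: measurable_funS mf.
apply: eq_measure_integral => [|maff A mA _]; first exact: measurable_affine.
exact: lebesgue_measure_affine.
Qed.

End affine1.

Section periodic1.
Context {R : realType}.
Variable (g : R -> \bar R).
Hypotheses (mg : measurable_fun setT g) (g0 : forall x, (0 <= g x)%E).
Hypothesis gper : forall x, g (x + 1) = g x.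

Let I a b : \bar R := (\int[lebesgue_measure]_(x in `[a, b[) g x)%E.

Let Ishift a b v : (\int[lebesgue_measure]_(x in `[a, b[) g (x + v)%R = I (a + v)%R (b + v)%R)%E.
Proof.
have := @ge0_integral_affine R 1 v `[a + v, b + v[ g ltr01 _ mg g0.
rewrite invr1 mul1e /I => <-//.
have -> : affine 1 v @^-1` `[a + v, b + v[%classic = `[a, b[%classic.
  by apply/seteqP; split => x /=; rewrite /affine !in_itv /= mul1r lerD2r ltrD2r.
by apply: eq_integral => x _; rewrite mul1r.
Qed.

Let perZ (z : int) x : g (x + z%:~R) = g x.
Proof.
have perN n y : g (y + n%:R) = g y.
  by elim: n y => [|n IH] y; rewrite ?addr0// -addn1 natrD addrA gper IH.
case: z => n; first exact: perN.
by rewrite NegzE mulrNz -[in RHS](subrK n.+1%:R x) perN.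
Qed.

Let Iint (z : int) a b : I (a + z%:~R) (b + z%:~R) = I a b.
Proof. by rewrite -Ishift; apply: eq_integral => x _; rewrite perZ. Qed.

Let Icat a b d : a <= b -> b <= d -> I a d = (I a b + I b d)%E.
Proof.
move=> ab bd; rewrite /I -ge0_integral_setU//.
- by rewrite -itv_bndbnd_setU// bnd_simp.
- exact: measurable_funS mg.
- apply/disj_setPS => x /= []; rewrite !in_itv/= => /andP[_ xb] /andP[bx _].
  by move: (lt_le_trans xb bx); rewrite ltxx.
Qed.

(** Any two intervals of length 1 agree up to integer translations: after an integer
shift the two overlap, and the piece sticking out on one side is an integer
translate of the piece missing on the other. *)
Lemma ge0_integral_period a c v :
  (\int[lebesgue_measure]_(x in `[a, (a + 1)%R[) g (x + v)%R =
   \int[lebesgue_measure]_(x in `[c, (c + 1)%R[) g x)%E.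
Proof.
rewrite Ishift (addrAC a) -/(I c (c + 1)); move: (a + v) => {a v} a.
pose z := Num.ceil (c - a); pose d := a + z%:~R.
have cd : c <= d by rewrite /d addrC -lerBlDr ceil_ge.
have dc : d <= c + 1.
  by have := ceilB1_lt (c - a); rewrite intrB -/z /d; lra.
rewrite -(Iint z) (addrAC a) -/d (Icat cd dc) (@Icat d (c + 1))// ?lerD2r//.
by rewrite addeC; congr adde; rewrite -(@Iint 1 c).
Qed.

End periodic1.

(** * Affine maps and periodic sets in higher dimension *)

Section affine_tuple.
Context {R : realType}.

Definition taffine k (c : R) (v : 'I_k -> R) (t : k.-tuple R) : k.-tuple R :=
  [tuple c * tnth t i + v i | i < k].

Lemma taffine_cons k c v x (t : k.-tuple R) :
  @taffine k.+1 c v (tuple_cons (x, t)) =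
  tuple_cons (c * x + v ord0, taffine c (v \o lift ord0) t).
Proof.
apply: eq_from_tnth => i; rewrite tnth_mktuple.
by case: (unliftP ord0 i) => [j ->|->]; rewrite ?tnthS ?tnth0//= ?tnthS ?tnth_mktuple.
Qed.

Definition tsection k (S : set (k.+1.-tuple R)) (x : R) : set (k.-tuple R) :=
  xsection (@tuple_cons R k @^-1` S) x.

Lemma measurable_tuple_cons_preimage k (S : set (k.+1.-tuple R)) :
  measurable S -> measurable (@tuple_cons R k @^-1` S).
Proof.
by move=> mS; rewrite -[X in measurable X]setTI; exact: measurable_tuple_cons.
Qed.

Lemma measurable_tsection k (S : set (k.+1.-tuple R)) x :
  measurable S -> measurable (tsection S x).
Proof. by move=> mS; apply: measurable_xsection; exact: measurable_tuple_cons_preimage. Qed.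

Lemma tsectionE k (S : set (k.+1.-tuple R)) x t :
  tsection S x t <-> S (tuple_cons (x, t)).
Proof. by rewrite /tsection xsectionE. Qed.

Lemma lebesgue_tuple_section k (S : set (k.+1.-tuple R)) :
  lebesgue_tuple k.+1 S =
  (\int[lebesgue_measure]_x lebesgue_tuple k (tsection S x))%E.
Proof. by []. Qed.

Lemma measurable_lebesgue_tsection k (S : set (k.+1.-tuple R)) : measurable S ->
  measurable_fun setT (fun x => lebesgue_tuple k (tsection S x)).
Proof.
move=> mS.
exact: (measurable_fun_xsection (lebesgue_tuple k) (measurable_tuple_cons_preimage mS)).
Qed.

(** Slicing along the first coordinate reduces the claim to dimension one. *)
Lemma lebesgue_tuple_affine k c v (S : set (k.-tuple R)) : 0 < c -> measurable S ->
  (lebesgue_tuple k (taffine c v @^-1` S) = (c^-1 ^+ k)%:E * lebesgue_tuple k S)%E.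
Proof.
move=> c0; elim: k v S => [|k IH] v S mS.
  rewrite expr0 mul1e; congr (lebesgue_tuple 0 _).
  suff -> : taffine c v = id by [].
  by apply/funext => t; rewrite [LHS]tuple0 [RHS]tuple0.
rewrite !lebesgue_tuple_section.
have E x : tsection (taffine c v @^-1` S) x =
    taffine c (v \o lift ord0) @^-1` tsection S (c * x + v ord0).
  by apply/seteqP; split => t; rewrite tsectionE /= taffine_cons => /tsectionE.
under eq_integral => x _.
  rewrite E IH; last exact: measurable_tsection.
  over.
rewrite ge0_integralZl_EFin//=.
- have := @ge0_integral_affine R c (v ord0) setT _ c0 measurableT (measurable_lebesgue_tsection mS).
  rewrite preimage_setT => ->//.
  by rewrite muleA -EFinM -exprSr.
- by move: (measurable_lebesgue_tsection mS) => /measurableT_comp; apply; exact: measurable_affine.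
- by rewrite exprn_ge0// invr_ge0 ltW.
Qed.

End affine_tuple.

Section torus.
Context {R : realType}.

Definition unit_box k (a : 'I_k -> R) : set (k.-tuple R) :=
  [set t | forall i, a i <= tnth t i < a i + 1].

Definition tperiodic k (S : set (k.-tuple R)) :=
  forall (z : 'I_k -> int) t, S t -> S (taffine 1 (fun i => (z i)%:~R) t).

Lemma measurable_unit_box k (a : 'I_k -> R) : measurable (unit_box a).
Proof.
rewrite (_ : unit_box a =
    \bigcap_(i in [set: 'I_k]) ((fun t => tnth t i) @^-1` `[a i, a i + 1[)).
  apply: fin_bigcap_measurable => // i _.
  by rewrite -[X in measurable X]setTI; apply: measurable_tnth.
apply/seteqP; split => t /= h i; first by move=> _ /=; rewrite in_itv/=; exact: h.
by have := h i I; rewrite /= in_itv.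
Qed.

Lemma tsection_unit_box k (a : 'I_k.+1 -> R) (S : set (k.+1.-tuple R)) x :
  tsection (unit_box a `&` S) x =
  if a ord0 <= x < a ord0 + 1 then unit_box (a \o lift ord0) `&` tsection S x
  else set0.
Proof.
apply/seteqP; split => t.
  move=> /tsectionE [bt St]; have /= := bt ord0; rewrite tnth0 => ->.
  by split => [i|]; [have := bt (lift ord0 i); rewrite tnthS|exact/tsectionE].
case: ifPn => // ax [bt /tsectionE St]; apply/tsectionE; split => //= i.
by case: (unliftP ord0 i) => [j ->|->]; rewrite ?tnthS ?tnth0//; exact: bt.
Qed.

Lemma lebesgue_tuple_unit_box_section k (a : 'I_k.+1 -> R) S :
  lebesgue_tuple k.+1 (unit_box a `&` S) =
  (\int[lebesgue_measure]_(x in `[a ord0, (a ord0 + 1)%R[)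
     lebesgue_tuple k (unit_box (a \o lift ord0) `&` tsection S x))%E.
Proof.
rewrite lebesgue_tuple_section [RHS]integral_mkcond; apply: eq_integral => x _.
by rewrite tsection_unit_box patchE mem_setE in_itv/=; case: ifPn; rewrite ?measure0.
Qed.

Lemma tsection_periodic k (S : set (k.+1.-tuple R)) x :
  tperiodic S -> tperiodic (tsection S x).
Proof.
move=> pS z t /tsectionE/(pS (fun i => oapp z 0 (unlift ord0 i))) h; apply/tsectionE.
move: h; rewrite taffine_cons unlift_none/= mul1r addr0; congr (S (tuple_cons (_, taffine _ _ _))).
by apply/funext => i /=; rewrite liftK.
Qed.

Lemma tsectionD1 k (S : set (k.+1.-tuple R)) x :
  tperiodic S -> tsection S (x + 1) = tsection S x.
Proof.
have T1 s : taffine 1 (fun=> 0) s = s :> k.-tuple R.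
  by apply: eq_from_tnth => i; rewrite tnth_mktuple mul1r addr0.
have step (e : int) y t : tperiodic S -> tsection S y t -> tsection S (y + e%:~R) t.
  move=> pS /tsectionE/(pS (fun i => if i == ord0 then e else 0)); rewrite taffine_cons/= mul1r.
  rewrite (_ : _ \o _ = fun=> 0) ?T1; first by move=> h; exact/tsectionE.
  by apply/funext => i.
move=> pS; apply/seteqP; split => t; last by move/(step 1); exact.
by move=> /(step (-1)) => /(_ pS); rewrite mulrNz addrK.
Qed.

(** Translations preserve Haar measure on the torus [R ^ k / Z ^ k], here read in two
arbitrary fundamental domains.  The measure of the slices of a periodic set is a
1-periodic function of the first coordinate, so that [ge0_integral_period] and
induction on the dimension apply. *)
Lemma lebesgue_tuple_torus_translation k (a c v : 'I_k -> R) (S : set (k.-tuple R)) :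
    measurable S -> tperiodic S ->
  lebesgue_tuple k (unit_box a `&` taffine 1 v @^-1` S) =
  lebesgue_tuple k (unit_box c `&` S).
Proof.
elim: k a c v S => [|k IH] a c v S mS pS.
  congr (lebesgue_tuple 0 _); apply/seteqP; split => t [_ St]; split; try by case.
    by move: St; rewrite /= (tuple0 (taffine _ _ _)) (tuple0 t).
  by move: St; rewrite /= (tuple0 (taffine _ _ _)) (tuple0 t).
rewrite !lebesgue_tuple_unit_box_section.
pose g x := lebesgue_tuple k (unit_box (c \o lift ord0) `&` tsection S x).
rewrite -(@ge0_integral_period R g _ _ _ (a ord0) (c ord0) (v ord0)).
- apply: eq_integral => x _.
  rewrite /g -[RHS](IH (a \o lift ord0) _ (v \o lift ord0)).
  + congr (lebesgue_tuple k _); apply/seteqP.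
    split => t [? h]; split=> //=; apply/tsectionE.
      by move/tsectionE: h; rewrite /= taffine_cons mul1r.
    by move/tsectionE: h; rewrite /= taffine_cons mul1r.
  + exact: measurable_tsection.
  + exact: tsection_periodic.
- have mB := measurable_unit_box (c \o lift ord0).
  have := measurable_fun_xsection (lebesgue_tuple k) (measurableI _ _
    (measurable_tuple_cons_preimage mS) (measurableX (@measurableT _ R) mB)).
  congr measurable_fun; apply/funext => x /=; congr (lebesgue_tuple k _).
  by rewrite xsectionI setIC /g in_xsectionX// inE.
- by move=> x; exact: measure_ge0.
- by move=> x; rewrite /g tsectionD1.
Qed.

End torus.

Section matrix_measure.
Context {R : realType}.
Implicit Types m n : nat.

Lemma measurable_mx_entry m n (i : 'I_m) (j : 'I_n) :
  measurable_fun setT (fun A : 'M[R]_(m, n) => A i j).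
Proof.
rewrite [X in measurable_fun _ X](_ : _ =
    (fun t => tnth t (mxvec_index i j)) \o @tuple_of_mx _ R m n).
  by apply: measurableT_comp; [exact: measurable_tnth|exact: measurable_tuple_of_mx].
by apply/funext => A /=; rewrite tnth_mktuple mxvecE.
Qed.

Lemma measurable_fun_mx d (T : measurableType d) m n (f : T -> 'M[R]_(m, n)) :
  (forall i j, measurable_fun setT (fun x => f x i j)) -> measurable_fun setT f.
Proof.
move=> mf; rewrite [X in measurable_fun _ X](_ : _ =
    @mx_of_tuple _ R m n \o (fun x => tuple_of_mx (f x))).
  apply: measurableT_comp; first exact: measurable_mx_of_tuple.
  apply/measurable_fun_tnthP => k.
  case/mxvec_indexP: k => i j; move: (mf i j); congr measurable_fun.
  by apply/funext => x /=; rewrite tnth_mktuple mxvecE.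
apply/funext => x /=; rewrite /mx_of_tuple /tuple_of_mx.
rewrite -[LHS]mxvecK; congr vec_mx; apply/rowP => k.
by rewrite mxE tnth_mktuple.
Qed.

Definition unit_cell m n (P : 'M[R]_(m, n)) : set 'M[R]_(m, n) :=
  [set A | forall i j, P i j <= A i j < P i j + 1].

Definition mx_periodic m n (S : set 'M[R]_(m, n)) :=
  forall (Z : 'M[int]_(m, n)) A, S A -> S (A + map_mx intr Z).

Lemma mx_of_tuple_affine m n c (V : 'M[R]_(m, n)) t :
  mx_of_tuple (taffine c (mxvec V 0) t) = c *: mx_of_tuple t + V.
Proof.
apply/matrixP => i j; rewrite /mx_of_tuple !mxE tnth_mktuple mxvecE.
by congr (c * tnth t _ + _).
Qed.

Lemma mx_of_tuple_unit_cell m n (P : 'M[R]_(m, n)) :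
  @mx_of_tuple _ R m n @^-1` unit_cell P = unit_box (mxvec P 0).
Proof.
apply/seteqP; split => t /= h => [k|i j].
  by case/mxvec_indexP: k => i j; have := h i j; rewrite !mxE mxvecE.
by have := h (mxvec_index i j); rewrite !mxE mxvecE.
Qed.

Lemma measurable_unit_cell m n (P : 'M[R]_(m, n)) : measurable (unit_cell P).
Proof.
rewrite (_ : unit_cell P = @tuple_of_mx _ R m n @^-1` unit_box (mxvec P 0)).
  by rewrite -[X in measurable X]setTI; apply: measurable_tuple_of_mx => //;
    exact: measurable_unit_box.
rewrite -mx_of_tuple_unit_cell -comp_preimage (_ : _ \o _ = id)//.
apply/funext => A /=; rewrite /mx_of_tuple -[RHS]mxvecK; congr vec_mx.
by apply/rowP => k; rewrite mxE tnth_mktuple.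
Qed.

Lemma lebesgue_mx_unit_cell m n (P : 'M[R]_(m, n)) : lebesgue_mx m n (unit_cell P) = 1%E.
Proof.
have := @lebesgue_mx_box R m n (fun i j => `[P i j, P i j + 1[%classic).
rewrite [X in lebesgue_mx _ _ X](_ : _ = unit_cell P).
  move=> ->//; rewrite big1// => i _; rewrite big1// => j _.
  by rewrite lebesgue_measure_itv/= lte_fin ltrDl ltr01 -EFinB addrAC subrr add0r.
by apply/seteqP; split => A h i j; have := h i j; rewrite /= in_itv.
Qed.

Lemma measurable_mx_of_tuple_preimage m n (S : set 'M[R]_(m, n)) :
  measurable S -> measurable (@mx_of_tuple _ R m n @^-1` S).
Proof.
by move=> mS; rewrite -[X in measurable X]setTI; apply: measurable_mx_of_tuple.
Qed.

Lemma lebesgue_mx_affine m n c V (S : set 'M[R]_(m, n)) : 0 < c -> measurable S ->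
  (lebesgue_mx m n ((fun A => (c *: A + V)%R) @^-1` S) =
   (c^-1 ^+ (m * n))%:E * lebesgue_mx m n S)%E.
Proof.
move=> c0 mS; rewrite !lebesgue_mxE.
rewrite -(@lebesgue_tuple_affine R _ c (mxvec V 0))//; last exact: measurable_mx_of_tuple_preimage.
by congr (lebesgue_tuple _ _); apply/seteqP; split => t /=; rewrite mx_of_tuple_affine.
Qed.

Lemma lebesgue_mx_torus_translation m n (P Q V : 'M[R]_(m, n)) (S : set 'M[R]_(m, n)) :
    measurable S -> mx_periodic S ->
  lebesgue_mx m n (unit_cell P `&` (fun A => A + V) @^-1` S) =
  lebesgue_mx m n (unit_cell Q `&` S).
Proof.
move=> mS pS; rewrite !lebesgue_mxE !preimage_setI !mx_of_tuple_unit_cell.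
rewrite -[RHS](@lebesgue_tuple_torus_translation R _ (mxvec P 0) _ (mxvec V 0))//.
- congr (lebesgue_tuple _ (_ `&` _)).
  by apply/seteqP; split => t /=; rewrite mx_of_tuple_affine scale1r.
- exact: measurable_mx_of_tuple_preimage.
- move=> z t /=.
  rewrite (_ : (fun i => _) = mxvec (map_mx intr (vec_mx (\row_k z k))) 0).
    by rewrite mx_of_tuple_affine scale1r; exact: pS.
  by apply/funext => k; case/mxvec_indexP: k => i j; rewrite mxvecE !mxE.
Qed.

End matrix_measure.

(** * Volume of balls and area of spheres *)

Section ball_volume.
Context {R : realType} (k : nat).
Local Notation vol := (lebesgue_mx k 1).
Local Notation B := (@unit_ball_volume R k).

Lemma measurable_enorm : measurable_fun setT (@enorm R k).
Proof.
apply: (@measurableT_comp _ _ _ _ _ _ (@Num.sqrt R)).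
  by apply: continuous_measurable_fun; exact: sqrt_continuous.
apply: measurable_sum => i; apply: measurable_funX.
exact: measurable_mx_entry.
Qed.

Lemma measurable_enorm_preimage (D : set R) : measurable D -> measurable (@enorm R k @^-1` D).
Proof. by move=> mD; rewrite -[X in measurable X]setTI; exact: measurable_enorm. Qed.

Definition closed_eball (r : R) : set 'cV[R]_k := [set x | enorm x <= r].
Definition open_eball (r : R) : set 'cV[R]_k := [set x | enorm x < r].

Lemma measurable_closed_eball r : measurable (closed_eball r).
Proof.
rewrite (_ : closed_eball r = @enorm R k @^-1` `]-oo, r]); first exact: measurable_enorm_preimage.
by apply/seteqP; split => x /=; rewrite in_itv.
Qed.

Lemma measurable_open_eball r : measurable (open_eball r).
Proof.
rewrite (_ : open_eball r = @enorm R k @^-1` `]-oo, r[); first exact: measurable_enorm_preimage.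
by apply/seteqP; split => x /=; rewrite in_itv.
Qed.

Lemma vol_scale r (S : set 'cV[R]_k) : 0 < r -> measurable S ->
  (vol ((fun x => (r^-1 *: x)%R) @^-1` S) = (r ^+ k)%:E * vol S)%E.
Proof.
move=> r0 mS; have r10 : 0 < r^-1 by rewrite invr_gt0.
have := @lebesgue_mx_affine R k 1 r^-1 0 S r10 mS; rewrite invrK muln1 => <-.
by congr (vol _); apply/seteqP; split => x /=; rewrite addr0.
Qed.

Lemma vol_closed_eballM r s : 0 < r ->
  (vol (closed_eball (r * s)) = (r ^+ k)%:E * vol (closed_eball s))%E.
Proof.
move=> r0; rewrite -vol_scale//; last exact: measurable_closed_eball.
congr (vol _); apply/seteqP; split => x /=; rewrite /closed_eball/= enormZ gtr0_norm ?invr_gt0//;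
  by rewrite [r^-1 * _]mulrC ler_pdivrMr// [r * _]mulrC.
Qed.

(** A ball small enough to fit in a unit cell: by scaling, it shows that all balls
have finite volume. *)
Lemma closed_eball_sub_cell : closed_eball 4^-1 `<=` unit_cell (const_mx (- 2^-1)).
Proof.
move=> x xr i j; rewrite ord1 mxE.
have /ler_normlP[h1 h2] := le_trans (le_entry_enorm x i) xr; lra.
Qed.

Lemma vol_closed_eball_fin : vol (closed_eball 1) \is a fin_num.
Proof.
have r0 : 0 < 4^-1 :> R by rewrite invr_gt0.
have : (vol (closed_eball 4^-1) <= 1)%E.
  rewrite -(@lebesgue_mx_unit_cell R k 1 (const_mx (- 2^-1))).
  apply: le_measure; rewrite ?inE; last exact: closed_eball_sub_cell.
    exact: measurable_closed_eball.
  exact: measurable_unit_cell.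
move=> le1; rewrite -(mulfV (_ : 4 != 0 :> R))// vol_closed_eballM//.
rewrite fin_numM// ge0_fin_numE ?measure_ge0//.
exact: le_lt_trans le1 (ltry _).
Qed.

Lemma vol_closed_eball r : 0 < r -> vol (closed_eball r) = (r ^+ k * B)%:E.
Proof.
move=> r0; rewrite -{1}(mulr1 r) vol_closed_eballM// EFinM; congr (_ * _)%E.
by rewrite fineK// vol_closed_eball_fin.
Qed.

Lemma unit_ball_volume_gt0 : 0 < B.
Proof.
pose r : R := Num.sqrt k%:R + 1.
have r0 : 0 < r by rewrite ltr_wpDl ?sqrtr_ge0.
have : (1 <= vol (closed_eball r))%E.
  rewrite -(@lebesgue_mx_unit_cell R k 1 0).
  apply: le_measure; rewrite ?inE.
  - exact: measurable_unit_cell.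
  - exact: measurable_closed_eball.
  - move=> x x01; apply: (@le_trans _ _ (Num.sqrt k%:R * 1)).
      apply: enorm_le_sqrt => // i; have := x01 i 0; rewrite mxE add0r => /andP[x0 x1].
      by rewrite ger0_norm// ltW.
    by rewrite mulr1 lerDl.
rewrite vol_closed_eball// lee_fin => h.
by rewrite -(pmulr_rgt0 _ (exprn_gt0 k r0)) (lt_le_trans ltr01).
Qed.

(** The open ball contains the closed balls of radius [r * (1 - e)], whose volumes
tend to that of the closed ball of radius [r]. *)
Lemma vol_open_eball r : 0 < r -> vol (open_eball r) = (r ^+ k * B)%:E.
Proof.
move=> r0; apply/eqP; rewrite eq_le; apply/andP; split.
  rewrite -vol_closed_eball//; apply: le_measure; rewrite ?inE.
  - exact: measurable_open_eball.
  - exact: measurable_closed_eball.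
  - by move=> x; exact: ltW.
have : (vol (open_eball r) <= (r ^+ k * B)%:E)%E.
  rewrite -vol_closed_eball//; apply: le_measure; rewrite ?inE.
  - exact: measurable_open_eball.
  - exact: measurable_closed_eball.
  - by move=> x; exact: ltW.
have V0 : (0 <= vol (open_eball r))%E by exact: measure_ge0.
case EV : (vol (open_eball r)) V0 => [V| |] V0 leV //.
rewrite lee_fin.
apply: (@cvgr_to_le _ (0 : R)^'+ _ R (fun e => (r * (1 - e)) ^+ k * B)).
  have -> : r ^+ k * B = (r * (1 - 0)) ^+ k * B by rewrite subr0 mulr1.
  apply: cvg_at_right_filter; apply: cvgMr_tmp; apply: cvg_exprn.
  by apply: cvgMl_tmp; apply: cvgB; [exact: cvg_cst|exact: cvg_id].
near=> e.
have e0 : 0 < e by near: e; exact: nbhs_right_gt.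
have e1 : e < 1 by near: e; exact: nbhs_right_lt.
have re0 : 0 < r * (1 - e) by rewrite mulr_gt0 ?subr_gt0.
rewrite -lee_fin -EV -vol_closed_eball//; apply: le_measure; rewrite ?inE.
- exact: measurable_closed_eball.
- exact: measurable_open_eball.
- move=> x /le_lt_trans; apply; rewrite gtr_pMr//; lra.
Unshelve. all: by end_near. Qed.

Lemma tubular_sphere e : 0 < e < 1 ->
  [set x : 'cV[R]_k | exists2 y, enorm y = 1 & enorm (x - y) < e] =
  open_eball (1 + e) `\` closed_eball (1 - e).
Proof.
move=> /andP[e0 e1]; apply/seteqP; split => x /=.
  move=> [y y1 xy]; rewrite /open_eball /closed_eball/=; split.
    have := enormD (x - y) y; rewrite subrK y1; lra.
  apply/negP; rewrite -ltNge.
  have := enormB x (x - y); rewrite opprB addrC subrK y1; lra.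
rewrite /open_eball /closed_eball/= => -[xe /negP]; rewrite -ltNge => ex.
have x0 : 0 < enorm x by lra.
exists ((enorm x)^-1 *: x); first by rewrite enormZ gtr0_norm ?invr_gt0// mulVf ?gt_eqF.
rewrite -{1}(scale1r x) -scalerBl enormZ -[X in _ * X](ger0_norm (enorm_ge0 x)) -normrM.
by rewrite mulrBl mul1r mulVf ?gt_eqF// ltr_norml; apply/andP; split; lra.
Qed.

(** The Minkowski content of the unit sphere is the limit of the volume of a shell,
[B * ((1 + e) ^+ k - (1 - e) ^+ k)], divided by its thickness [2 * e]. *)
Lemma unit_sphere_areaE : unit_sphere_area k = k%:R * B.
Proof.
rewrite /unit_sphere_area /surface_area; apply: cvg_lim => //.
have cv : (\sum_(i < k) (1 + e) ^+ (k.-1 - i) * (1 - e) ^+ i) * B @[e --> 0^'+] --> k%:R * B.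
  apply: cvgMr_tmp; apply: cvg_subrXX_factor; apply: cvg_at_right_filter.
    suff : 1 + e @[e --> (0 : R)] --> (1 + 0 : R) by rewrite addr0.
    by apply: cvgD; [exact: cvg_cst|exact: cvg_id].
  suff : 1 - e @[e --> (0 : R)] --> (1 - 0 : R) by rewrite subr0.
  by apply: cvgB; [exact: cvg_cst|exact: cvg_id].
apply: cvg_trans cv; apply: near_eq_cvg; near=> e.
have e0 : 0 < e by near: e; exact: nbhs_right_gt.
have e1 : e < 1 by near: e; exact: nbhs_right_lt.
have re0 : 0 < 1 - e by rewrite subr_gt0.
have re1 : 0 < 1 + e by lra.
rewrite tubular_sphere ?e0//.
have -> : vol (open_eball (1 + e) `\` closed_eball (1 - e)) =
    ((1 + e) ^+ k * B - (1 - e) ^+ k * B)%:E.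
  transitivity (vol (open_eball (1 + e)) - vol (closed_eball (1 - e)))%E; last first.
    by rewrite vol_open_eball// vol_closed_eball.
  rewrite measureD.
  - congr (_ - lebesgue_mx k 1 _)%E; apply: setIidr => x; rewrite /open_eball /closed_eball/=; lra.
  - exact: measurable_open_eball.
  - exact: measurable_closed_eball.
  - by have := vol_open_eball re1 => /= ->; exact: ltry.
rewrite /= -mulrBl subrXX (_ : 1 + e - (1 - e) = 2 * e); last by ring.
rewrite [2 * e * _]mulrC [RHS]mulrAC mulfK; last by rewrite mulf_neq0// gt_eqF.
congr (_ * _); apply: eq_bigr => i _; congr ((1 + e) ^+ _ * _).
Unshelve. all: by end_near. Qed.

End ball_volume.

(** * Pairwise independence on the torus *)

Section independence.
Context {R : realType} (m n : nat).
Local Notation MA := 'M[R]_(m, n).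
Local Notation V := 'cV[R]_m.
Local Notation volA := (lebesgue_mx m n).
Local Notation volw := (lebesgue_mx m 1).
Local Notation mu := (lebesgue_mx m n \x lebesgue_mx m 1)%E.
Implicit Types (E : set V) (q : 'cV[int]_n).

Definition realv k (q : 'cV[int]_k) : 'cV[R]_k := map_mx intr q.

(** For a periodic [E] this is, on the torus of pairs [(A, w)], the preimage of [E]
under the homomorphism [(A, w) |-> w - A q]. *)
Definition hit E q : set (MA * V) := [set Aw | E (Aw.2 - Aw.1 *m realv q)].

Lemma measurable_hit E q : measurable E -> measurable (hit E q).
Proof.
move=> mE; suff mf : measurable_fun setT (fun Aw : MA * V => Aw.2 - Aw.1 *m realv q).
  by rewrite -[X in measurable X]setTI; exact: mf.
apply: measurable_fun_mx => i j.
rewrite [X in measurable_fun _ X](_ : _ = fun Aw : MA * V =>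
  Aw.2 i j - \sum_l Aw.1 i l * realv q l j); last first.
  by apply/funext => Aw; rewrite !mxE.
apply: measurable_funB.
  exact: (measurableT_comp (measurable_mx_entry i j) measurable_snd).
apply: measurable_sum => l; apply: measurable_funM => //.
exact: (measurableT_comp (measurable_mx_entry i l) measurable_fst).
Qed.

Lemma mx_periodicI a b (S S' : set 'M[R]_(a, b)) :
  mx_periodic S -> mx_periodic S' -> mx_periodic (S `&` S').
Proof. by move=> pS pS' Z A [/(pS Z) ? /(pS' Z) ?]. Qed.

Lemma mx_periodic_shift E v : mx_periodic E -> mx_periodic ((fun w => w + v) @^-1` E).
Proof. by move=> pE Z w /=; rewrite addrAC; exact: pE. Qed.

Lemma measurable_shift E v : measurable E -> measurable ((fun w => w + v) @^-1` E).
Proof.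
move=> mE; suff mf : measurable_fun setT (fun w : V => w + v).
  by rewrite -[X in measurable X]setTI; exact: mf.
apply: measurable_fun_mx => i j.
rewrite [X in measurable_fun _ X](_ : _ = fun w : V => w i j + v i j).
  by apply: measurable_funD => //; exact: measurable_mx_entry.
by apply/funext => w; rewrite mxE.
Qed.

Definition cell (P : MA) (W : V) : set (MA * V) := unit_cell P `*` unit_cell W.

Lemma measurable_cell P W : measurable (cell P W).
Proof. by apply: measurableX; exact: measurable_unit_cell. Qed.

Lemma mu_cell P W : mu (cell P W) = 1%E.
Proof.
transitivity (volA (unit_cell P) * volw (unit_cell W))%E.
  by apply: product_measure1E; exact: measurable_unit_cell.
by rewrite !lebesgue_mx_unit_cell mule1.
Qed.

Lemma xsection_cellI P W (S : set (MA * V)) A :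
  xsection (cell P W `&` S) A =
  if A \in unit_cell P then unit_cell W `&` xsection S A else set0.
Proof.
rewrite xsectionI; case: ifPn => AP; first by rewrite in_xsectionX.
by rewrite notin_xsectionX// set0I.
Qed.

Lemma mu_cell_section P W (S : set (MA * V)) :
  mu (cell P W `&` S) =
  (\int[volA]_(A in unit_cell P) volw (unit_cell W `&` xsection S A))%E.
Proof.
rewrite [RHS]integral_mkcond; apply: eq_integral => A _.
transitivity (volw (xsection (cell P W `&` S) A)) => //.
by rewrite xsection_cellI patchE; case: ifPn => // _; exact: measure0.
Qed.

(** For fixed [A], the section of [hit E q] is a translate of [E]. *)
Lemma mu_hit P W Q E q : measurable E -> mx_periodic E ->
  mu (cell P W `&` hit E q) = volw (unit_cell Q `&` E).
Proof.
move=> mE pE; rewrite mu_cell_section.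
rewrite (eq_integral (cst (volw (unit_cell Q `&` E)))).
  transitivity (volw (unit_cell Q `&` E) * volA (unit_cell P))%E.
    by apply: integral_cst; exact: measurable_unit_cell.
  by rewrite lebesgue_mx_unit_cell mule1.
move=> A _; rewrite -[RHS](@lebesgue_mx_torus_translation _ _ _ W _ (- (A *m realv q)))//.
by congr (lebesgue_mx _ _ (_ `&` _)); apply/seteqP; split => w /=; rewrite /hit /= xsectionE.
Qed.

Lemma mu_ysection P W (S : set (MA * V)) : measurable S ->
  mu (cell P W `&` S) =
  (\int[volw]_(w in unit_cell W) volA (unit_cell P `&` ysection S w))%E.
Proof.
move=> mS; have mX := measurableI _ _ (measurable_cell P W) mS.
transitivity ((volA \x^ volw) (cell P W `&` S))%E.
  by apply: product_measure_unique => // X Y mX' mY; exact: product_measure2E.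
rewrite [RHS]integral_mkcond; apply: eq_integral => w _.
transitivity (volA (ysection (cell P W `&` S) w)) => //.
rewrite patchE ysectionI; case: ifPn => wW; first by rewrite in_ysectionX.
by rewrite notin_ysectionX// set0I; exact: measure0.
Qed.

(** The matrix [D] is supported on one column, at a nonzero entry of [q]. *)
Lemma mx_linear_onto q (w : V) : q != 0 -> exists D : MA, D *m realv q = w.
Proof.
move=> q0; have [j qj] : exists j, q j 0 != 0.
  apply/existsP; apply: contraNT q0 => /existsPn h; apply/eqP/colP => j.
  by rewrite mxE; apply/eqP; move: (h j); rewrite negbK.
exists (\matrix_(i, l) (if l == j then w i 0 / (q j 0)%:~R else 0)).
apply/colP => i; rewrite mxE (bigD1 j)//= big1 ?addr0; last first.
  by move=> l lj; rewrite !mxE (negbTE lj) mul0r.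
by rewrite !mxE eqxx divfK// intr_eq0.
Qed.

(** If [D q = - w], replacing [A] by [A + D] turns the condition [E' (w - A q)] into
[E' (- (A q))].  As the translation by [D] preserves the measure of periodic sets,
the set of the [A] with [E' (w - A q)] has the same measure for all [w]: the two
conditions are independent.  The common measure is then computed by taking for
[E] the whole space, where [mu_hit] applies. *)
Lemma mu_hit_shear P W Q E E' q : measurable E -> measurable E' ->
    mx_periodic E' -> q != 0 ->
  mu (cell P W `&` ((setT `*` E) `&` hit E' q)) =
  (volw (unit_cell W `&` E) * volw (unit_cell Q `&` E'))%E.
Proof.
move=> mE mE' pE' q0.
pose T := [set A : MA | E' (- (A *m realv q))].
have mT : measurable T.
  suff mf : measurable_fun setT (fun A : MA => - (A *m realv q)).
    by rewrite -[X in measurable X]setTI; exact: mf.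
  apply: measurable_fun_mx => i j.
  rewrite [X in measurable_fun _ X](_ : _ = fun A : MA => - \sum_l A i l * realv q l j); last first.
    by apply/funext => A; rewrite !mxE.
  apply: measurable_funN; apply: measurable_sum => l; apply: measurable_funM => //.
  exact: measurable_mx_entry.
have pT : mx_periodic T.
  move=> Z A; rewrite /T /= => /(pE' (- (Z *m q))); congr (E' _).
  by rewrite mulmxDl opprD map_mxN map_mxM.
have secT w : volA (unit_cell P `&` ysection (hit E' q) w) = volA (unit_cell P `&` T).
  have [D Dw] := mx_linear_onto (- w) q0.
  rewrite -[RHS](@lebesgue_mx_torus_translation _ _ _ P _ D)//.
  congr (lebesgue_mx _ _ (_ `&` _)); apply/seteqP.
  by split => A /=; rewrite ysectionE /T /hit /= mulmxDl Dw opprD opprK addrC.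
have key F : measurable F -> mu (cell P W `&` ((setT `*` F) `&` hit E' q)) =
    (volw (unit_cell W `&` F) * volA (unit_cell P `&` T))%E.
  move=> mF; rewrite mu_ysection; last first.
    by apply: measurableI; [exact: measurableX|exact: measurable_hit].
  transitivity (\int[volw]_(w in unit_cell W `&` F) cst (volA (unit_cell P `&` T)) w)%E; last first.
    rewrite muleC; apply: integral_cst.
    by apply: measurableI => //; exact: measurable_unit_cell.
  rewrite [LHS]integral_mkcond [RHS]integral_mkcond; apply: eq_integral => w _.
  rewrite !patchE in_setI ysectionI; case: ifPn => // wW; rewrite andTb.
  have [wF|wF] := boolP (w \in F).
    by rewrite in_ysectionX// setTI; exact: secT.
  by rewrite notin_ysectionX// set0I setI0; exact: measure0.
rewrite key//; congr (_ * _)%E.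
rewrite -(@mu_hit P W _ _ q)//.
have := key setT measurableT.
by rewrite setXTT setTI setIT lebesgue_mx_unit_cell mul1e => ->.
Qed.

(** For fixed [A], translating [w] by [A q] replaces [w - A q] and [w - A q'] by [w]
and [w - A (q' - q)]. *)
Lemma mu_hit2 P W Q E E' q q' : measurable E -> measurable E' ->
    mx_periodic E -> mx_periodic E' -> q != q' ->
  mu (cell P W `&` (hit E q `&` hit E' q')) =
  (volw (unit_cell Q `&` E) * volw (unit_cell Q `&` E'))%E.
Proof.
move=> mE mE' pE pE' qq'.
transitivity (mu (cell P Q `&` ((setT `*` E) `&` hit E' (q' - q)))); last first.
  by rewrite (mu_hit_shear P _ Q)// subr_eq0 eq_sym.
rewrite !mu_cell_section; apply: eq_integral => A _.
pose S := E `&` (fun w => w + A *m (realv q - realv q')) @^-1` E'.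
transitivity (volw (unit_cell Q `&` S)).
  rewrite -[RHS](@lebesgue_mx_torus_translation _ _ _ W _ (- (A *m realv q)))//.
  - congr (lebesgue_mx _ _ (_ `&` _)); rewrite xsectionE.
    apply/seteqP; split => w; rewrite /S /hit /= mulmxBr.
      by move=> [? ?]; split => //; rewrite addrA subrK.
    by rewrite addrA subrK.
  - by apply: measurableI => //; exact: measurable_shift.
  - by apply: mx_periodicI => //; exact: mx_periodic_shift.
congr (lebesgue_mx _ _ (_ `&` _)); rewrite xsectionE; apply/seteqP.
have rB : realv (q' - q) = realv q' - realv q by rewrite /realv map_mxB.
by split => w; rewrite /S /hit /= rB !mulmxBr opprB => -[] // [].
Qed.

End independence.

Section near_lattice.
Context {R : realType} (m : nat).
Implicit Types (x : 'cV[R]_m) (p : 'cV[int]_m) (r : R).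

Definition near_lattice r : set 'cV[R]_m :=
  [set x | exists p : 'cV[int]_m, enorm (x + realv p) <= r].

Lemma measurable_near_lattice r : measurable (near_lattice r).
Proof.
rewrite (_ : near_lattice r =
    \bigcup_p (fun x => x + realv p) @^-1` @closed_eball R m r).
  apply: countable_bigcupT_measurable => [|p]; first exact: countableP.
  by apply: measurable_shift; exact: measurable_closed_eball.
by apply/seteqP; split => x [p]; [exists p|move=> _; exists p].
Qed.

Lemma near_lattice_periodic r : mx_periodic (near_lattice r).
Proof.
move=> Z x [p xp]; exists (p - Z).
by rewrite /realv map_mxB addrACA subrr addr0 -/(realv p) [_ + realv p]addrC addrC.
Qed.

Lemma intr_abs_lt1 (z : int) : `|z%:~R : R| < 1 -> z = 0.
Proof. by rewrite -intr_norm -[1]/(1%:~R) ltr_int => h; apply/eqP; rewrite -normr_le0; lia. Qed.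

(** Two integer vectors within [r < 1/2] of the same point differ by less than 1 in
each coordinate. *)
Lemma nearby_lattice_point_unique r x p p' : r < 2^-1 ->
  enorm (x + realv p) <= r -> enorm (x + realv p') <= r -> p = p'.
Proof.
move=> r2 xp xp'; apply/colP => i; apply/eqP; rewrite -subr_eq0; apply/eqP.
apply: intr_abs_lt1; rewrite intrB.
have := le_trans (le_entry_enorm _ i) xp; have := le_trans (le_entry_enorm _ i) xp'.
rewrite !mxE => /ler_normlP[h1 h2] /ler_normlP[h3 h4]; rewrite ltr_norml; apply/andP; split; lra.
Qed.

(** In the cell centred at the origin, only the integer vector 0 can be within [r] of
a point. *)
Lemma vol_near_lattice r : 0 < r -> r < 2^-1 ->
  lebesgue_mx m 1 (unit_cell (const_mx (- 2^-1)) `&` near_lattice r) =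
  (r ^+ m * unit_ball_volume m)%:E.
Proof.
move=> r0 r2; rewrite -vol_closed_eball//; congr (lebesgue_mx _ _ _).
apply/seteqP; split => x.
  move=> [xc [p xp]]; suff p0 : p = 0.
    by move: xp; rewrite p0 /realv map_mx0 addr0.
  apply/colP => i; rewrite mxE; apply: intr_abs_lt1.
  have := le_trans (le_entry_enorm _ i) xp; have := xc i 0.
  rewrite !mxE => /andP[h1 h2] /ler_normlP[h3 h4]; rewrite ltr_norml; apply/andP; split; lra.
move=> xr; split; last by exists 0; rewrite /realv map_mx0 addr0.
move=> i j; rewrite ord1 mxE.
have /ler_normlP[h1 h2] := le_trans (le_entry_enorm x i) xr; apply/andP; split; lra.
Qed.

End near_lattice.

(** * A strong law for pairwise independent events *)

Section pairwise_independent_events.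
Context d (T : measurableType d) (R : realType) (mu : {measure set T -> \bar R}).
Variables (Q : set T) (I : eqType) (D : {pred I}) (E : I -> set T) (v : I -> R).
Hypotheses (mQ : measurable Q) (muQ : mu Q = 1%E).
Hypothesis mE : forall i, measurable (E i).
Hypothesis muE : forall i, i \in D -> mu (Q `&` E i) = (v i)%:E.
Hypothesis muE2 : forall i j, i \in D -> j \in D -> i != j ->
  mu (Q `&` (E i `&` E j)) = (v i * v j)%:E.

Definition occurrences (s : seq I) (x : T) : R := \sum_(i <- s) \1_(E i) x.

Let V (s : seq I) : R := \sum_(i <- s) v i.

Let v_ge0 i : i \in D -> 0 <= v i.
Proof. by move=> iD; rewrite -lee_fin -muE// measure_ge0. Qed.

Let measurable_occurrences s : measurable_fun setT (occurrences s).
Proof. by apply: measurable_sum => i; exact: measurable_indic. Qed.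

Lemma occurrences_ge0 s x : 0 <= occurrences s x.
Proof. by apply: sumr_ge0 => i _; rewrite indicE. Qed.

Let int_occurrences s : {subset s <= D} ->
  (\int[mu]_(x in Q) (occurrences s x)%:E = (V s)%:E)%E.
Proof.
move=> sD; under eq_integral do rewrite /occurrences -sumEFin.
rewrite ge0_integral_sum//; last by move=> i; exact/measurable_EFinP.
rewrite /V -sumEFin; apply: eq_big_seq => i /sD iD.
by rewrite integral_indic// setIC muE.
Qed.

Let int_occurrences2 s : {subset s <= D} -> uniq s ->
  (\int[mu]_(x in Q) (occurrences s x ^+ 2)%:E <= (V s + V s ^+ 2)%:E)%E.
Proof.
move=> sD us.
have -> : (\int[mu]_(x in Q) (occurrences s x ^+ 2)%:E =
    \sum_(i <- s) \sum_(j <- s) mu (Q `&` (E i `&` E j)))%E.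
  transitivity (\int[mu]_(x in Q)
      \sum_(i <- s) \sum_(j <- s) (\1_(E i `&` E j) x)%:E)%E.
    apply: eq_integral => x _; rewrite expr2 {1}/occurrences mulr_suml -sumEFin.
    apply: eq_bigr => i _; rewrite /occurrences mulr_sumr -sumEFin.
    by apply: eq_bigr => j _; rewrite indicI.
  have mI i j : measurable_fun Q (fun x => (\1_(E i `&` E j) x)%:E : \bar R).
    by apply/measurable_EFinP; apply: measurable_indic; exact: measurableI.
  have I0 i j x : (0 <= (\1_(E i `&` E j) x)%:E :> \bar R)%E by rewrite lee_fin indicE.
  rewrite ge0_integral_sum//; last 2 first.
  - by move=> i; apply: emeasurable_sum => j; exact: mI.
  - by move=> i x _; apply: sume_ge0 => j _; exact: I0.
  apply: eq_bigr => i _; rewrite ge0_integral_sum//; apply: eq_bigr => j _.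
  by rewrite integral_indic ?(setIC Q)//; exact: measurableI.
have -> : V s + V s ^+ 2 = \sum_(i <- s) (v i + v i * V s).
  by rewrite big_split /= -mulr_suml expr2.
rewrite -sumEFin big_seq [leRHS]big_seq; apply: lee_sum => i si.
have iD := sD _ si; rewrite (bigD1_seq i)//= setIid muE// EFinD leeD2l//.
rewrite {1}/V (bigD1_seq i)//= mulrDr EFinD mulr_sumr -sumEFin.
rewrite -[leLHS]add0e leeD ?lee_fin ?mulr_ge0 ?v_ge0//.
rewrite big_seq_cond [leRHS]big_seq_cond; apply: lee_sum => j /andP[sj ji].
by rewrite muE2// ?sD// eq_sym.
Qed.

(** Pairwise independence makes the off-diagonal covariances vanish.  The identity
[(X - V) ^+ 2 + 2 V X = X ^+ 2 + V ^+ 2] is used to expand the square because all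
its terms are nonnegative, so that their integrals add up without any
integrability condition. *)
Lemma variance_occurrences s : {subset s <= D} -> uniq s ->
  (\int[mu]_(x in Q) ((occurrences s x - V s) ^+ 2)%:E <= (V s)%:E)%E.
Proof.
move=> sD us.
have V0 : 0 <= V s by rewrite /V big_seq; apply: sumr_ge0 => i /sD/v_ge0.
have mX : measurable_fun Q (occurrences s) by exact: measurable_funS (measurable_occurrences s).
have mXV : measurable_fun Q (fun x => ((occurrences s x - V s) ^+ 2)%:E).
  by apply/measurable_EFinP; apply: measurable_funX; exact: measurable_funB.
have eqI : (\int[mu]_(x in Q) ((occurrences s x - V s) ^+ 2)%:E + (2 * V s * V s)%:E =
   \int[mu]_(x in Q) (occurrences s x ^+ 2)%:E + (V s ^+ 2)%:E)%E.
  have -> : ((2 * V s * V s)%:E = \int[mu]_(x in Q) (2 * V s * occurrences s x)%:E)%E.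
    under [RHS]eq_integral do rewrite EFinM.
    rewrite ge0_integralZl_EFin ?int_occurrences ?EFinM ?mulr_ge0//.
    - by move=> x _; rewrite lee_fin occurrences_ge0.
    - exact/measurable_EFinP.
  have -> : ((V s ^+ 2)%:E = \int[mu]_(x in Q) cst (V s ^+ 2)%:E x)%E.
    by rewrite integral_cst// muQ mule1.
  rewrite -!ge0_integralD//.
  - by apply: eq_integral => x _; rewrite -!EFinD; congr (_%:E); rewrite /=; ring.
  - by move=> x _; rewrite lee_fin sqr_ge0.
  - by apply/measurable_EFinP; apply: measurable_funX.
  - by move=> x _; rewrite lee_fin sqr_ge0.
  - by move=> x _; rewrite lee_fin sqr_ge0.
  - by move=> x _; rewrite lee_fin !mulr_ge0// occurrences_ge0.
  - by apply/measurable_EFinP; apply: measurable_funM.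
rewrite -(@leeD2rE _ (2 * V s * V s)%:E)// eqI.
rewrite (le_trans (leeD2r _ (int_occurrences2 sD us)))//.
by rewrite -!EFinD lee_fin le_eqVlt; apply/orP; left; apply/eqP; ring.
Qed.

(** The squared relative error at the [j]-th step has mean at most [1 / V (F j)].
These means being summable, the sum over [j] of the squared relative errors is
integrable, hence almost surely finite, and its terms tend to 0. *)
Lemma slln_along (F : nat -> seq I) :
    (forall j, {subset F j <= D}) -> (forall j, uniq (F j)) ->
    (forall j, 0 < V (F j)) -> (\sum_(0 <= j <oo) ((V (F j))^-1)%:E < +oo)%E ->
  {ae mu, forall x, Q x -> occurrences (F j) x / V (F j) @[j --> \oo] --> (1 : R)}.
Proof.
move=> FD uF V0 sumV.
pose u j x := ((occurrences (F j) x - V (F j)) / V (F j)) ^+ 2.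
have u0 j x : 0 <= u j x by exact: sqr_ge0.
have mu_ j : measurable_fun Q (fun x => (u j x)%:E).
  apply/measurable_EFinP; apply: measurable_funX; apply: measurable_funM => //.
  by apply: measurable_funB => //; exact: measurable_funS (measurable_occurrences _).
pose G x := (\sum_(0 <= j <oo) (u j x)%:E)%E.
have G0 x : (0 <= G x)%E by apply: nneseries_ge0 => j _ _; rewrite lee_fin.
have mG : measurable_fun Q G.
  by apply: ge0_emeasurable_sum => // j x _ _; rewrite lee_fin.
have intG : mu.-integrable Q G.
  apply/integrableP; split => //.
  under eq_integral do rewrite gee0_abs//.
  rewrite integral_nneseries//; last by move=> j x _; rewrite lee_fin.
  apply: le_lt_trans sumV; apply: lee_nneseries => [j _ _|j _].
    by apply: integral_ge0 => x _; rewrite lee_fin.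
  have W0 : 0 <= (V (F j))^-1 ^+ 2 by exact: sqr_ge0.
  rewrite (eq_integral (fun x => ((V (F j))^-1 ^+ 2)%:E *
      ((occurrences (F j) x - V (F j)) ^+ 2)%:E)%E); last first.
    by move=> x _; rewrite -EFinM -exprMn mulrC.
  rewrite ge0_integralZl_EFin//; last 2 first.
  - by move=> x _; rewrite lee_fin sqr_ge0.
  - apply/measurable_EFinP; apply: measurable_funX; apply: measurable_funB => //.
    exact: measurable_funS (measurable_occurrences _).
  rewrite (le_trans (lee_wpmul2l _ (variance_occurrences (FD j) (uF j))))//.
  by rewrite -EFinM lee_fin expr2 -mulrA mulVf ?mulr1// gt_eqF.
apply: filterS (integrable_ae mQ intG) => x Gx Qx.
have /nnseries_is_cvg : (\sum_(0 <= j <oo) (u j x)%:E < +oo)%E.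
  by have := Gx Qx; rewrite ge0_fin_numE.
move=> /(_ (u0 ^~ x))/cvg_series_cvg_0 ux0.
have : Num.sqrt (u j x) @[j --> \oo] --> Num.sqrt (0 : R).
  by apply: (@continuous_cvg _ _ _ _ _ _ (@Num.sqrt R)) => //; exact: sqrt_continuous.
rewrite sqrtr0 => /cvgr0Pnorm_lt h.
apply/cvgrPdist_lt => e e0; apply: filterS (h e e0) => j.
by rewrite /u sqrtr_sqr normr_id mulrBl mulfV ?gt_eqF// distrC.
Qed.

End pairwise_independent_events.

(** * Integer points in balls *)

Section lattice_points.
Context {R : realType} (n : nat).
Implicit Types (q : 'cV[int]_n) (a b c r : R).

Lemma finite_int_box (N : nat) : finite_set [set q : 'cV[int]_n | forall i, `|q i 0| <= N%:Z].
Proof.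
pose f (u : 'cV['I_(N + N).+1]_n) : 'cV[int]_n := \col_i ((u i 0 : nat)%:Z - N%:Z).
apply: (@sub_finite_set _ _ (f @` setT)); last exact/finite_image/finite_finset.
move=> q qN; exists (\col_i inord (absz (q i 0 + N%:Z))) => //.
apply/colP => i; rewrite !mxE; have := qN i; move: (q i 0) => z zN.
by rewrite inordK; lia.
Qed.

Definition shell a b : set 'cV[int]_n := [set q | a <= enorm (realv q : 'cV[R]_n) < b].

Lemma finite_eball r (x : 'cV[R]_n) : finite_set [set q | enorm (x + realv q) <= r].
Proof.
pose N := Num.trunc (r + enorm x).
apply: sub_finite_set (finite_int_box N.+1) => q /= qr i.
have : `|(q i 0)%:~R| <= r + enorm x.
  have := le_trans (le_entry_enorm _ i) qr.
  have := le_entry_enorm x i; rewrite !mxE => h1 h2.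
  have -> : (q i 0)%:~R = (x i 0 + (q i 0)%:~R) - x i 0 by rewrite addrAC subrr add0r.
  by rewrite (le_trans (ler_normB _ _))// lerD.
move=> /le_lt_trans h; have {}h := h _ (truncnS_gt _).
by move: h; rewrite -intr_norm -[N.+1%:R]/((N.+1%:Z)%:~R) ltr_int => /ltW.
Qed.

Lemma finite_shell a b : finite_set (shell a b).
Proof.
apply: sub_finite_set (finite_eball b 0) => q /= /andP[_ /ltW].
by rewrite add0r.
Qed.
#[local] Hint Resolve finite_shell : core.

Lemma shell_cat a b c : a <= b -> b <= c -> shell a c = shell a b `|` shell b c.
Proof.
move=> ab bc; apply/seteqP; split => q; rewrite /shell /=.
  by move=> /andP[h1 h2]; case: (ltP (enorm (realv q)) b) => h; [left|right]; apply/andP.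
by move=> [] /andP[h1 h2]; apply/andP; split => //; [exact: lt_le_trans bc|exact: le_trans h1].
Qed.

Lemma shell_sum_cat (f : 'cV[int]_n -> R) a b c : a <= b -> b <= c ->
  \sum_(q \in shell a c) f q = \sum_(q \in shell a b) f q + \sum_(q \in shell b c) f q.
Proof.
move=> ab bc; rewrite (shell_cat ab bc) fsbigU0// => q [] /= /andP[_ qb] /andP[bq _].
by move: (lt_le_trans qb bq); rewrite ltxx.
Qed.

Definition lattice_count r : R := \sum_(q \in shell 0 r) (1 : R).

(** The unit cells with integer corners are pairwise disjoint. *)
Lemma vol_lattice_cells r :
  lebesgue_mx n 1 (\bigcup_(q in shell 0 r) unit_cell (realv q)) = (lattice_count r)%:E.
Proof.
transitivity (\sum_(q \in shell 0 r) lebesgue_mx n 1 (unit_cell (realv q : 'cV[R]_n)))%E.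
  apply: measure_fin_bigcup => //; last by move=> q _; exact: measurable_unit_cell.
  move=> q q' _ _ [x [xq xq']]; apply/colP => i.
  have := xq i 0; have := xq' i 0; rewrite !mxE => h h'.
  by rewrite -[LHS](floor_def (x := x i 0)) ?intrD1// -[RHS](floor_def (x := x i 0)) ?intrD1.
rewrite /lattice_count -fsumEFin//; apply: eq_fsbigr => q _.
exact: lebesgue_mx_unit_cell.
Qed.

Lemma unit_cell_sub_enorm q (x : 'cV[R]_n) : unit_cell (realv q) x ->
  enorm (x - realv q) <= Num.sqrt n%:R.
Proof.
move=> xq; rewrite -[leRHS]mulr1; apply: enorm_le_sqrt => // i.
have := xq i 0; rewrite !mxE => /andP[h1 h2]; rewrite ger0_norm ?subr_ge0//.
by rewrite lerBlDr addrC ltW.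
Qed.

(** A point of a unit cell is within [sqrt n] of its corner, so that the cells with
corners in the ball of radius [r] are contained in the ball of radius
[r + sqrt n]. *)
Lemma lattice_count_le r : 0 < r + Num.sqrt n%:R ->
  lattice_count r <= unit_ball_volume n * (r + Num.sqrt n%:R) ^+ n.
Proof.
move=> r0; rewrite mulrC -lee_fin -vol_open_eball// -vol_lattice_cells.
apply: le_measure; rewrite ?inE.
- apply: fin_bigcup_measurable => // q _; exact: measurable_unit_cell.
- exact: measurable_open_eball.
- move=> x [q /andP[_ qr] /unit_cell_sub_enorm xq]; rewrite /open_eball /=.
  by rewrite -(subrK (realv q) x) addrC (le_lt_trans (enormD _ _))// ltr_leD.
Qed.

(** Every point lies in the cell whose corner is given by the integer parts of its
coordinates; for a point of the ball of radius [r - sqrt n] this corner is in the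
ball of radius [r]. *)
Lemma lattice_count_ge r : 0 < r - Num.sqrt n%:R ->
  unit_ball_volume n * (r - Num.sqrt n%:R) ^+ n <= lattice_count r.
Proof.
move=> r0; rewrite mulrC -lee_fin -vol_open_eball// -vol_lattice_cells.
apply: le_measure; rewrite ?inE.
- exact: measurable_open_eball.
- apply: fin_bigcup_measurable => // q _; exact: measurable_unit_cell.
- move=> x; rewrite /open_eball /= => xr.
  pose q : 'cV[int]_n := \col_i Num.floor (x i 0).
  have xq : unit_cell (realv q) x.
    by move=> i j; rewrite ord1 !mxE -intrD1; exact: floor_itv.
  exists q => //; rewrite /shell/= enorm_ge0/=.
  have := unit_cell_sub_enorm xq; have := enormB x (x - realv q).
  rewrite subKr; lra.
Qed.

End lattice_points.

Section lattice_sum.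
Context {R : realType} (n : nat).
Local Notation B := (@unit_ball_volume R n).
Local Notation s := (Num.sqrt n%:R : R).
Local Notation znorm q := (enorm (realv q : 'cV[R]_n)).
Implicit Types (a b r : R).

Definition lattice_sum r : R := \sum_(q \in @shell R n 1 r) (znorm q)^-1 ^+ n.

Lemma lattice_count_shell a b : 0 <= a -> a <= b ->
  lattice_count n b - lattice_count n a = \sum_(q \in @shell R n a b) (1 : R).
Proof.
by move=> a0 ab; rewrite /lattice_count (shell_sum_cat _ a0 ab) addrAC subrr add0r.
Qed.

Lemma lattice_sum_shell a b : 1 <= a -> a <= b ->
  lattice_sum b - lattice_sum a = \sum_(q \in @shell R n a b) (znorm q)^-1 ^+ n.
Proof.
by move=> a0 ab; rewrite /lattice_sum (shell_sum_cat _ a0 ab) addrAC subrr add0r.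
Qed.

Lemma lattice_sum1 : lattice_sum 1 = 0.
Proof.
by apply: fsbig1 => q /= /andP[q1 q2]; move: (le_lt_trans q1 q2); rewrite ltxx.
Qed.

Lemma lattice_sum_ge0 r : 0 <= lattice_sum r.
Proof. by apply: fsumr_ge0 => q _; rewrite exprn_ge0// invr_ge0 enorm_ge0. Qed.

Lemma le_lattice_sum r r' : r <= r' -> lattice_sum r <= lattice_sum r'.
Proof.
move=> rr'; have [r1|r1] := leP 1 r.
  rewrite -subr_ge0 lattice_sum_shell//; apply: fsumr_ge0 => q _.
  by rewrite exprn_ge0// invr_ge0 enorm_ge0.
rewrite [leLHS]fsbig1 ?lattice_sum_ge0// => q /= /andP[q1 q2].
by move: (le_lt_trans q1 (lt_trans q2 r1)); rewrite ltxx.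
Qed.

Lemma lattice_sum_shell_le a b : 1 <= a -> a <= b ->
  lattice_sum b - lattice_sum a <= a^-1 ^+ n * (lattice_count n b - lattice_count n a).
Proof.
move=> a1 ab; have a0 : 0 < a by exact: lt_le_trans a1.
rewrite lattice_sum_shell// lattice_count_shell ?(ltW a0)// mulr_fsumr.
rewrite !fsbig_finite; try exact: finite_shell.
rewrite big_seq [leRHS]big_seq; apply: ler_sum => q.
rewrite in_fset_set ?inE; last exact: finite_shell.
move=> /andP[aq qb]; rewrite mulr1.
have q0 : 0 < enorm (realv q : 'cV[R]_n) by exact: lt_le_trans aq.
by apply: lerXn2r; rewrite ?nnegrE ?invr_ge0 ?(ltW a0) ?(ltW q0)// lef_pV2 ?posrE.
Qed.

Lemma lattice_sum_shell_ge a b : 1 <= a -> a <= b ->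
  b^-1 ^+ n * (lattice_count n b - lattice_count n a) <= lattice_sum b - lattice_sum a.
Proof.
move=> a1 ab; have a0 : 0 < a by exact: lt_le_trans a1.
have b0 : 0 < b by exact: lt_le_trans ab.
rewrite lattice_sum_shell// lattice_count_shell ?(ltW a0)// mulr_fsumr.
rewrite !fsbig_finite; try exact: finite_shell.
rewrite big_seq [leRHS]big_seq; apply: ler_sum => q.
rewrite in_fset_set ?inE; last exact: finite_shell.
move=> /andP[aq qb]; rewrite mulr1.
have q0 : 0 < enorm (realv q : 'cV[R]_n) by exact: lt_le_trans aq.
by apply: lerXn2r; rewrite ?nnegrE ?invr_ge0 ?(ltW b0) ?(ltW q0)// lef_pV2 ?posrE// ltW.
Qed.

Let t (k : nat) : R := k.+1%:R^-1.
(** The gaps between these radii tend to infinity, so that boundary errors of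
   size [sqrt n] are negligible in a shell, whereas their ratios tend to 1, so
   that the norm is almost constant on a shell. *)
Let rad (k : nat) : R := k.+1%:R ^+ 2.

Let t_gt0 k : 0 < t k. Proof. by rewrite invr_gt0. Qed.

Let t_cvg0 : t k @[k --> \oo] --> (0 : R).
Proof. exact: cvg_harmonic. Qed.

Lemma cvg_div_ln1D : t k / ln (1 + t k) @[k --> \oo] --> (1 : R).
Proof.
apply: (@squeeze_cvgr _ _ _ _ (fun=> 1) (fun k => 1 + t k)).
- near=> k; have tk := t_gt0 k.
  have l0 : 0 < ln (1 + t k) by rewrite ln_gt0// ltrDl.
  rewrite ler_pdivlMr// mul1r le_ln1Dx ?(lt_trans _ tk)//= ler_pdivrMr//.
  have t10 : 0 < 1 + t k by rewrite ltr_wpDl.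
  have := @le_ln1Dx R (- (t k / (1 + t k))).
  rewrite (_ : 1 + - (t k / (1 + t k)) = (1 + t k)^-1); last by field; rewrite gt_eqF.
  rewrite lnV ?posrE// lerN2 ler_pdivrMr// [ln _ * _]mulrC; apply.
  by rewrite ltrN2 ltr_pdivrMr// mul1r ltrDr.
- exact: cvg_cst.
- by rewrite -[X in _ --> X]addr0; apply: cvgD => //; exact: cvg_cst.
Unshelve. all: by end_near. Qed.

Let rad_gt0 k : 0 < rad k. Proof. by rewrite exprn_gt0. Qed.
Let rad_ge1 k : 1 <= rad k. Proof. by rewrite expr_ge1// ler1n. Qed.
Let le_rad i j : (i <= j)%N -> rad i <= rad j.
Proof. by move=> ij; rewrite lerXn2r ?nnegrE// ler_nat. Qed.

Let ln_rad k : ln (rad k.+1) - ln (rad k) = 2 * ln (1 + t k).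
Proof.
rewrite -ln_div ?posrE// mulr_natl -lnXn ?(ltr_wpDl ler01)//.
congr ln; rewrite /rad /t -[k.+2%:R]natr1; field.
by rewrite gt_eqF// ltr_pwDl.
Qed.

(** With [t = 1 / (k + 1)], the radii are [t ^- 2] and [((1 + t) / t) ^+ 2], and the
difference of their logarithms is [2 * ln (1 + t)].  The sum over the shell is
squeezed by bounding [|q|] by the two radii, and the number of points by the
volumes [B * (rad +- s) ^+ n]; after factoring [x ^+ n - y ^+ n], both bounds are
[B * (1 + O(t))] times a sum which tends to [n]. *)
Lemma lattice_sum_shell_cvg :
  (lattice_sum (rad k.+1) - lattice_sum (rad k)) / (ln (rad k.+1) - ln (rad k))
    @[k --> \oo] --> n%:R * B.
Proof.
pose w k := t k / ln (1 + t k).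
pose hi k := B * (w k * (1 + (2^-1 + s) * t k)) *
  \sum_(i < n) ((1 + t k) ^+ 2 + s * t k ^+ 2) ^+ (n.-1 - i) * (1 - s * t k ^+ 2) ^+ i.
pose lo k := B * (w k * ((1 + (2^-1 - s) * t k) * (1 + t k)^-1 ^+ 2)) *
  \sum_(i < n) (1 - s * t k ^+ 2 * (1 + t k)^-1 ^+ 2) ^+ (n.-1 - i) *
                ((1 + s * t k ^+ 2) * (1 + t k)^-1 ^+ 2) ^+ i.
have c2 : t k ^+ 2 @[k --> \oo] --> (0 : R).
  suff : t k ^+ 2 @[k --> \oo] --> (0 : R) ^+ 2 by rewrite expr0n.
  exact: cvg_exprn.
have cst2 : s * t k ^+ 2 @[k --> \oo] --> (0 : R).
  by rewrite -(mulr0 s); exact: cvgMl_tmp.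
have c1 : 1 + t k @[k --> \oo] --> (1 : R).
  by rewrite -[X in _ --> X]addr0; apply: cvgD => //; exact: cvg_cst.
have cV : (1 + t k)^-1 ^+ 2 @[k --> \oo] --> (1 : R).
  suff : (1 + t k)^-1 ^+ 2 @[k --> \oo] --> (1^-1 : R) ^+ 2 by rewrite invr1 expr1n.
  by apply: cvg_exprn; apply: cvgV => //; exact: oner_neq0.
have clin (c : R) : 1 + c * t k @[k --> \oo] --> (1 : R).
  rewrite -[X in _ --> X]addr0; apply: cvgD; first exact: cvg_cst.
  by rewrite -(mulr0 c); exact: cvgMl_tmp.
have hi_cvg : hi k @[k --> \oo] --> n%:R * B.
  suff : hi k @[k --> \oo] --> B * (1 * 1) * n%:R by rewrite !mulr1 mulrC.
  apply: cvgM; first by apply: cvgMl_tmp; apply: cvgM; [exact: cvg_div_ln1D|exact: clin].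
  apply: cvg_subrXX_factor.
    rewrite -[X in _ --> X]addr0; apply: cvgD => //.
    suff : (1 + t k) ^+ 2 @[k --> \oo] --> (1 : R) ^+ 2 by rewrite expr1n.
    exact: cvg_exprn.
  by rewrite -[X in _ --> X]subr0; apply: cvgB => //; exact: cvg_cst.
have lo_cvg : lo k @[k --> \oo] --> n%:R * B.
  suff : lo k @[k --> \oo] --> B * (1 * (1 * 1)) * n%:R by rewrite !mulr1 mulrC.
  apply: cvgM.
    apply: cvgMl_tmp; apply: cvgM; first exact: cvg_div_ln1D.
    by apply: cvgM => //; exact: clin.
  apply: cvg_subrXX_factor.
    rewrite -[X in _ --> X]subr0; apply: cvgB; first exact: cvg_cst.
    by rewrite -(mul0r 1); exact: cvgM.
  rewrite -[X in _ --> X]mulr1; apply: cvgM => //.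
  by rewrite -[X in _ --> X]addr0; apply: cvgD => //; exact: cvg_cst.
apply: squeeze_cvgr lo_cvg hi_cvg; near=> k.
have sk : s < rad k.
  apply: (@lt_le_trans _ _ (s + 1)); first by rewrite ltrDl.
  apply: (@le_trans _ _ k.+1%:R); last by rewrite /rad expr2 ler_peMr// ler1n.
  by apply: (@le_trans _ _ k%:R); [near: k; exact: nbhs_infty_ger|rewrite ler_nat].
have s0 : 0 <= s by exact: sqrtr_ge0.
have tk := t_gt0 k; have l0 : 0 < ln (1 + t k) by rewrite ln_gt0// ltrDl.
have rr : rad k <= rad k.+1 by exact: le_rad.
have L1 : lattice_count n (rad k.+1) <= B * (rad k.+1 + s) ^+ n.
  by apply: lattice_count_le; rewrite ltr_wpDr.
have L2 : B * (rad k.+1 - s) ^+ n <= lattice_count n (rad k.+1).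
  by apply: lattice_count_ge; rewrite subr_gt0 (lt_le_trans sk).
have L3 : lattice_count n (rad k) <= B * (rad k + s) ^+ n.
  by apply: lattice_count_le; rewrite ltr_wpDr.
have L4 : B * (rad k - s) ^+ n <= lattice_count n (rad k).
  by apply: lattice_count_ge; rewrite subr_gt0.
have t10 : 0 < 1 + t k by rewrite ltr_wpDl.
have radE : rad k = (t k)^-1 ^+ 2 by rewrite /rad /t invrK.
have radS : rad k.+1 = ((1 + t k) / t k) ^+ 2.
  by rewrite /rad -[k.+2%:R]natr1 mulrDl mul1r /t invrK mulVf// addrC.
rewrite ln_rad; apply/andP; split.
  rewrite ler_pdivlMr ?mulr_gt0//.
  apply: le_trans (lattice_sum_shell_ge (rad_ge1 k) rr).
  apply: (@le_trans _ _ ((rad k.+1)^-1 ^+ n * (B * ((rad k.+1 - s) ^+ n - (rad k + s) ^+ n)))).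
    have -> : (rad k.+1)^-1 ^+ n * (B * ((rad k.+1 - s) ^+ n - (rad k + s) ^+ n)) =
        B * (((rad k.+1 - s) / rad k.+1) ^+ n - ((rad k + s) / rad k.+1) ^+ n).
      by rewrite !exprMn; ring.
    have -> : (rad k.+1 - s) / rad k.+1 = 1 - s * t k ^+ 2 * (1 + t k)^-1 ^+ 2.
      by rewrite radS; field; rewrite !gt_eqF.
    have -> : (rad k + s) / rad k.+1 = (1 + s * t k ^+ 2) * (1 + t k)^-1 ^+ 2.
      by rewrite radS radE; field; rewrite !gt_eqF.
    rewrite subrXX /lo /w; set S := \sum_(i < n) _.
    rewrite le_eqVlt; apply/orP; left; apply/eqP.
    by field; rewrite !gt_eqF.
  by rewrite ler_pM2l ?exprn_gt0 ?invr_gt0// mulrBr lerB.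
rewrite ler_pdivrMr ?mulr_gt0//.
apply: le_trans (lattice_sum_shell_le (rad_ge1 k) rr) _.
apply: (@le_trans _ _ ((rad k)^-1 ^+ n * (B * ((rad k.+1 + s) ^+ n - (rad k - s) ^+ n)))).
  by rewrite ler_pM2l ?exprn_gt0 ?invr_gt0// mulrBr lerB.
have -> : (rad k)^-1 ^+ n * (B * ((rad k.+1 + s) ^+ n - (rad k - s) ^+ n)) =
    B * (((rad k.+1 + s) / rad k) ^+ n - ((rad k - s) / rad k) ^+ n).
  by rewrite !exprMn; ring.
have -> : (rad k.+1 + s) / rad k = (1 + t k) ^+ 2 + s * t k ^+ 2.
  by rewrite radS radE; field; rewrite !gt_eqF.
have -> : (rad k - s) / rad k = 1 - s * t k ^+ 2.
  by rewrite radE; field; rewrite !gt_eqF.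
rewrite subrXX /hi /w; set S := \sum_(i < n) _.
rewrite le_eqVlt; apply/orP; left; apply/eqP.
by field; rewrite !gt_eqF.
Unshelve. all: by end_near. Qed.

(** By [stolz_cesaro] applied to the shells, the claim holds along the sequence [rad]. *)
Lemma lattice_sum_asymptotic : lattice_sum T / ln T @[T --> +oo] --> n%:R * B.
Proof.
have rad1 k : 1 < rad k.+1 by rewrite expr_gt1// ltr1n.
have rad_ge k : k%:R <= rad k.
  by apply: (@le_trans _ _ k.+1%:R); rewrite ?ler_nat// /rad expr2 ler_peMr// ler1n.
have rad_y : rad k @[k --> \oo] --> +oo.
  apply/cvgryPge => A; near=> k; apply: le_trans (rad_ge k).
  by near: k; exact: nbhs_infty_ger.
have ln_rad_y : ln (rad k) @[k --> \oo] --> +oo.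
  apply/cvgryPge => A; near=> k.
  rewrite -[A]expRK ler_ln ?posrE ?expR_gt0//.
  by near: k; move/cvgryPge: rad_y; exact.
apply: (@cvg_log_interpolation _ _ (fun k => rad k.+1)).
- exact: le_lattice_sum.
- exact: lattice_sum_ge0.
- by move=> i j ij; exact: le_rad.
- exact: rad1.
- by rewrite (cvg_shiftS rad).
- pose c := ln (rad 1).
  have c0 : 0 < c by rewrite ln_gt0.
  apply: (@squeeze_cvgr _ _ _ _ (fun=> 1) (fun k => 1 + 2 / c * t k.+1)).
  + near=> k.
    have ck : c <= ln (rad k.+1) by rewrite ler_ln ?posrE// le_rad.
    have l0 : 0 < ln (rad k.+1) by exact: lt_le_trans ck.
    have l1 : 0 <= ln (1 + t k.+1) by rewrite ln_ge0// lerDl ltW.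
    have -> : ln (rad k.+2) = ln (rad k.+1) + 2 * ln (1 + t k.+1) by rewrite -ln_rad addrC subrK.
    rewrite mulrDl mulfV ?gt_eqF// lerDl lerD2l mulr_ge0 ?mulr_ge0 ?invr_ge0 ?(ltW l0)//=.
    rewrite -!mulrA ler_pM2l// mulrC ler_pM ?invr_ge0 ?(ltW l0)//.
      by rewrite lef_pV2 ?posrE.
    by rewrite le_ln1Dx// (lt_trans _ (t_gt0 _)).
  + exact: cvg_cst.
  + suff : 1 + 2 / c * t k.+1 @[k --> \oo] --> 1 + 2 / c * 0 by rewrite mulr0 addr0.
    apply: cvgD; first exact: cvg_cst.
    by apply: cvgMl_tmp; rewrite (cvg_shiftS t).
- pose a k := lattice_sum (rad k.+1) - lattice_sum (rad k).
  pose b k := ln (rad k.+1) - ln (rad k).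
  have rad0 : rad 0 = 1 by rewrite /rad expr1n.
  have suma K : \sum_(k < K) a k = lattice_sum (rad K).
    rewrite -(big_mkord xpredT a) (telescope_sumr (fun k => lattice_sum (rad k)))//.
    by rewrite rad0 lattice_sum1 subr0.
  have sumb K : \sum_(k < K) b k = ln (rad K).
    rewrite -(big_mkord xpredT b) (telescope_sumr (fun k => ln (rad k)))//.
    by rewrite rad0 ln1 subr0.
  rewrite (cvg_shiftS (fun K => lattice_sum (rad K) / ln (rad K))).
  under eq_fun do rewrite -suma -sumb.
  apply: stolz_cesaro lattice_sum_shell_cvg.
    by move=> k; rewrite /b ln_rad mulr_gt0// ln_gt0// ltrDl.
  by under eq_fun do rewrite sumb.
Unshelve. all: by end_near. Qed.

End lattice_sum.

(** * Counting solutions *)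

Section counting_solutions.
Context {R : realType} (m n : nat) (b : R).
Local Notation znorm q := (enorm (realv q : 'cV[R]_n)).
Implicit Types (A : 'M[R]_(m, n)) (w : 'cV[R]_m) (T : R).

Definition target_radius (q : 'cV[int]_n) : R := b * znorm q `^ (- (n%:R / m%:R)).

Definition approx_event (q : 'cV[int]_n) : set ('M[R]_(m, n) * 'cV[R]_m) :=
  hit (near_lattice (target_radius q)) q.

Lemma counting_fsum (I : choiceType) (S : set I) : finite_set S ->
  counting S = (\sum_(x \in S) (1 : R))%:E.
Proof.
move=> fS; rewrite /counting asboolT// fsbig_finite//.
by rewrite big_const_seq count_predT iter_addr_0.
Qed.

Definition solutions A w (D : set 'cV[int]_n) : set ('cV[int]_m * 'cV[int]_n) :=
  [set pq | D pq.2 /\ enorm (w - A *m realv pq.2 + realv pq.1) <= target_radius pq.2].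

Lemma finite_solutions A w D : finite_set D -> finite_set (solutions A w D).
Proof.
move=> fD; apply: (@sub_finite_set _ _
  (\bigcup_(q in D) ([set p | enorm (w - A *m realv q + realv p) <= target_radius q] `*` [set q]))).
  by move=> [p q] /= [Dq pq]; exists q.
apply: bigcup_finite => // q _; apply: finite_setX => //.
exact: finite_eball.
Qed.

Lemma num_solutionsE A w T :
  num_solutions A w b T = counting (solutions A w (@shell R n 1 T)).
Proof.
have E p q : enorm (A *m map_mx intr q - map_mx intr p - w) =
    enorm (w - A *m realv q + realv p).
  by rewrite -enormN !opprD !opprK [RHS]/= addrC addrA.
by rewrite /num_solutions; congr counting; apply/seteqP; split => -[p q] /=; rewrite E => -[].
Qed.

(** Beyond the radius [R0] each [q] has at most one partner [p], so that a solution
is determined by [q]. *)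
Lemma solutions_count_cat A w R0 T : 1 <= R0 -> R0 <= T ->
    (forall q, R0 <= znorm q -> target_radius q < 2^-1) ->
  num_solutions A w b T =
  (\sum_(x \in solutions A w (@shell R n 1 R0)) (1 : R) +
   occurrences R approx_event (finmap.enum_fset (fset_set (@shell R n R0 T))) (A, w))%:E.
Proof.
move=> R01 R0T small.
rewrite num_solutionsE (shell_cat _ R01 R0T).
have -> : solutions A w (shell 1 R0 `|` shell R0 T) =
    solutions A w (shell 1 R0) `|` solutions A w (shell R0 T).
  apply/seteqP; split => -[p q]; rewrite /solutions /=.
    by move=> [[?|?] ?]; [left|right].
  by move=> [[? ?]|[? ?]]; split => //; [left|right].
have fin a c : finite_set (solutions A w (@shell R n a c)).
  by apply: finite_solutions; exact: finite_shell.
rewrite counting_fsum ?finite_setU// fsbigU0//; last first.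
  move=> -[p q] [[/andP[_ /= h1] _] [/andP[/= h2 _] _]].
  by move: (lt_le_trans h1 h2); rewrite ltxx.
congr (_ + _)%:E.
have inj : set_inj (solutions A w (@shell R n R0 T)) snd.
  move=> [p q] [p' q'] /set_mem[/= /andP[qR _] h] /set_mem[_ /= h'] qq'.
  by rewrite -qq' in h' *; congr pair; exact: nearby_lattice_point_unique (small _ qR) h h'.
rewrite -(fsbig_image _ _ (fun=> (1 : R)) inj).
have -> : snd @` solutions A w (shell R0 T) =
    shell R0 T `&` [set q | approx_event q (A, w)].
  apply/seteqP; split => [_ [[p q] [/= sq h] <-]|q [sq [p h]]].
    by split => //; exists p.
  by exists (p, q).
rewrite fsbig_mkcondr fsbig_finite; last exact: finite_shell.
apply: eq_bigr => q _; rewrite indicE /=.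
have -> : (q \in [set q0 | approx_event q0 (A, w)]) = ((A, w) \in approx_event q).
  by apply/idP/idP; rewrite !inE.
by case: (_ \in _).
Qed.

End counting_solutions.

Section almost_sure_count.
Context {R : realType} (m n : nat) (b : R).
Hypotheses (m0 : (0 < m)%N) (n0 : (0 < n)%N) (b0 : 0 < b).
Local Notation znorm q := (enorm (realv q : 'cV[R]_n)).
Local Notation ev := (@approx_event R m n b).
Local Notation mu := (lebesgue_mx m n \x lebesgue_mx m 1)%E.

Lemma target_radius_gt0 (q : 'cV[int]_n) : 0 < znorm q -> 0 < target_radius m b q.
Proof. by move=> q0; rewrite mulr_gt0// powR_gt0. Qed.

Lemma target_radius_expr (q : 'cV[int]_n) : 0 < znorm q ->
  target_radius m b q ^+ m = b ^+ m * (znorm q)^-1 ^+ n.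
Proof.
move=> q0; rewrite /target_radius exprMn -(powR_mulrn m (powR_ge0 _ _)) -powRrM mulNr.
rewrite divfK ?pnatr_eq0 -?lt0n//.
by rewrite powRN powR_mulrn ?ltW// exprVn.
Qed.

(** The bound [R0] exceeds the solution [x] of [b * x ^ (- n / m) = 1/2]. *)
Lemma target_radius_eventually_small : exists2 R0 : R, 1 <= R0 &
  forall q : 'cV[int]_n, R0 <= znorm q -> target_radius m b q < 2^-1.
Proof.
have nm0 : 0 < n%:R / m%:R :> R by rewrite divr_gt0 ?ltr0n.
have b20 : 0 <= 2 * b by rewrite mulr_ge0// ltW.
exists (1 + (2 * b) `^ (n%:R / m%:R)^-1); first by rewrite lerDl powR_ge0.
move=> q qR; rewrite /target_radius powRN.
have q0 : 0 < znorm q.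
  by apply: lt_le_trans qR; rewrite ltr_pwDl// powR_ge0.
have : 2 * b < znorm q `^ (n%:R / m%:R).
  have E : 2 * b = ((2 * b) `^ (n%:R / m%:R)^-1) `^ (n%:R / m%:R).
    by rewrite -powRrM mulVf ?lt0r_neq0// powRr1.
  rewrite [ltLHS]E.
  apply: (gt0_ltr_powR nm0); rewrite ?nnegrE ?powR_ge0 ?(ltW q0)//.
  by apply: lt_le_trans qR; rewrite ltrDr.
move=> h; rewrite ltr_pdivrMr ?powR_gt0//; lra.
Qed.

Variable R0 : R.
Hypotheses (R01 : 1 <= R0) (small : forall q, R0 <= znorm q -> target_radius m b q < 2^-1).

Local Notation Q0 := (const_mx (- 2^-1) : 'cV[R]_m).
Local Notation Bm := (@unit_ball_volume R m).
Local Notation Bn := (@unit_ball_volume R n).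
Let v (q : 'cV[int]_n) : R := b ^+ m * Bm * (znorm q)^-1 ^+ n.
Let Sh (T : R) : seq 'cV[int]_n := finmap.enum_fset (fset_set (@shell R n R0 T)).
Let X T := occurrences R ev (Sh T).
Let far : {pred 'cV[int]_n} := [pred q | R0 <= znorm q].
Let kappa := b ^+ m * Bm * (n%:R * Bn).

Let mem_Sh T q : (q \in Sh T) = (R0 <= znorm q < T).
Proof.
rewrite /Sh in_fset_set; last exact: finite_shell.
by apply/idP/idP; rewrite inE.
Qed.

Let Sh_far T : {subset Sh T <= far}.
Proof. by move=> q; rewrite mem_Sh => /andP[]. Qed.

Let sum_v T : R0 <= T ->
  \sum_(q <- Sh T) v q = b ^+ m * Bm * (lattice_sum n T - lattice_sum n R0).
Proof.
move=> RT; rewrite lattice_sum_shell// fsbig_finite; last exact: finite_shell.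
by rewrite mulr_sumr.
Qed.

Let kappa_gt0 : 0 < kappa.
Proof. by rewrite !mulr_gt0 ?exprn_gt0 ?unit_ball_volume_gt0 ?ltr0n. Qed.

Let vol_far q : q \in far ->
  lebesgue_mx m 1 (unit_cell Q0 `&` near_lattice (target_radius m b q)) = (v q)%:E.
Proof.
move=> qR; have q0 : 0 < znorm q by apply: lt_le_trans qR; exact: lt_le_trans R01.
by rewrite vol_near_lattice ?small ?target_radius_gt0// target_radius_expr// mulrAC.
Qed.

Let mu_event P W q : q \in far -> mu (cell P W `&` ev q) = (v q)%:E.
Proof.
move=> qf; rewrite (mu_hit P W Q0) ?vol_far//; first exact: measurable_near_lattice.
exact: near_lattice_periodic.
Qed.

Let mu_event2 P W q q' : q \in far -> q' \in far -> q != q' ->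
  mu (cell P W `&` (ev q `&` ev q')) = (v q * v q')%:E.
Proof.
move=> qf qf' qq'; rewrite (mu_hit2 P W Q0) ?vol_far//;
  by [exact: measurable_near_lattice | exact: near_lattice_periodic].
Qed.

Let V_asymptotic : (\sum_(q <- Sh T) v q) / ln T @[T --> +oo] --> kappa.
Proof.
have : b ^+ m * Bm * (lattice_sum n T / ln T - lattice_sum n R0 * (ln T)^-1)
    @[T --> +oo] --> b ^+ m * Bm * (n%:R * Bn - lattice_sum n R0 * 0).
  apply: cvgMl_tmp; apply: cvgB; first exact: lattice_sum_asymptotic.
  apply: cvgMl_tmp; apply/gtr0_cvgV0.
    by near=> T; rewrite ln_gt0//; near: T; apply: nbhs_pinfty_gt; exact: num_real.
  apply/cvgryPge => a; near=> T.
  have T0 : expR a <= T by near: T; apply: nbhs_pinfty_ge; exact: num_real.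
  by rewrite -[a]expRK ler_ln ?posrE ?expR_gt0// (lt_le_trans (expR_gt0 a)).
rewrite mulr0 subr0; apply: cvg_trans; apply: near_eq_cvg; near=> T.
rewrite sum_v; last by near: T; apply: nbhs_pinfty_ge; exact: num_real.
by rewrite -mulrBl mulrA.
Unshelve. all: by end_near. Qed.

Let X_nondecreasing x y z : x <= y -> X x z <= X y z.
Proof.
move=> xy; rewrite /X /occurrences /Sh -!fsbig_finite; try exact: finite_shell.
have [Rx|xR] := leP R0 x.
  rewrite [leRHS](shell_sum_cat _ Rx xy) lerDl.
  by apply: fsumr_ge0 => q _; rewrite indicE.
rewrite [leLHS]fsbig1; first by apply: fsumr_ge0 => q _; rewrite indicE.
by move=> q /andP[Rq qx]; move: (lt_trans (le_lt_trans Rq qx) xR); rewrite ltxx.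
Qed.

Let X_ge0 x z : 0 <= X x z. Proof. exact: occurrences_ge0. Qed.

(** The strong law is used along [T_j = exp ((j + J) ^ 2)]: the means at [T_j] have
order [j ^ 2], hence summable inverses, and yet [ln T_(j+1) / ln T_j] tends to 1.
The shift [J] puts all the [T_j] in the range where the mean is at least half of
its asymptotic value. *)
Lemma ae_occurrences_asymptotic P W :
  {ae mu, forall Aw, cell P W Aw -> X T Aw / ln T @[T --> +oo] --> kappa}.
Proof.
have [T0 [T0r HT0]] : exists T0, T0 \is Num.real /\
    forall T, T0 < T -> R0 <= T /\ kappa / 2 <= (\sum_(q <- Sh T) v q) / ln T.
  have : \forall T \near +oo, R0 <= T /\ kappa / 2 <= (\sum_(q <- Sh T) v q) / ln T.
    near=> T; split; first by near: T; apply: nbhs_pinfty_ge; exact: num_real.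
    near: T; have /cvgrPdist_le := V_asymptotic => /(_ (kappa / 2)).
    have k20 : 0 < kappa / 2 by rewrite divr_gt0.
    move=> /(_ k20); apply: filterS => T /ler_normlP[h1 h2]; lra.
  by move=> [T0 [? ?]]; exists T0.
pose J := (Num.trunc T0).+1.
pose u (j : nat) : R := (j + J)%:R.
pose T j := expR (u j ^+ 2).
have u1 j : 1 <= u j by rewrite ler1n addn_gt0 orbT.
have u0 j : 0 < u j by exact: lt_le_trans (u1 j).
have lnT j : ln (T j) = u j ^+ 2 by rewrite expRK.
have T0T j : T0 < T j.
  have : T0 < J%:R by exact: truncnS_gt.
  move=> /lt_le_trans; apply; apply: (@le_trans _ _ (u j)); first by rewrite ler_nat leq_addl.
  apply: (@le_trans _ _ (u j ^+ 2)); first by rewrite expr2 ler_peMr// ltW.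
  by apply: le_trans (expR_ge1Dx _); rewrite lerDr.
have Vj j : kappa / 2 * u j ^+ 2 <= \sum_(q <- Sh (T j)) v q.
  by have [_] := HT0 _ (T0T j); rewrite lnT ler_pdivlMr ?exprn_gt0.
have V0 j : 0 < \sum_(q <- Sh (T j)) v q.
  by apply: lt_le_trans (Vj j); rewrite mulr_gt0 ?exprn_gt0// divr_gt0.
have uy : u j @[j --> \oo] --> +oo.
  apply/cvgryPge => a; near=> j.
  apply: (@le_trans _ _ j%:R); last by rewrite ler_nat leq_addr.
  by near: j; exact: nbhs_infty_ger.
have Ty : T j @[j --> \oo] --> +oo.
  apply/cvgryPge => a; near=> j.
  apply: (@le_trans _ _ (u j)); first by near: j; move/cvgryPge: uy; exact.
  apply: (@le_trans _ _ (u j ^+ 2)); first by rewrite expr2 ler_peMr// ltW.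
  by apply: le_trans (expR_ge1Dx _); rewrite lerDr.
have sumV : (\sum_(0 <= j <oo) ((\sum_(q <- Sh (T j)) v q)^-1)%:E < +oo)%E.
  have k20 : 0 <= 2 / kappa by rewrite divr_ge0// ltW.
  apply: le_lt_trans (nneseries_inv_sqr k20); apply: lee_nneseries => j _ //=.
    by rewrite lee_fin invr_ge0 ltW.
  rewrite lee_fin -[2 / kappa]invf_div -invfM lef_pV2 ?posrE//.
    apply: le_trans (Vj j); rewrite ler_pM2l ?divr_gt0//.
    by rewrite lerXn2r ?nnegrE ?(ltW (u0 j))// ler_nat /J addnS ltnS leq_addr.
  by rewrite mulr_gt0 ?divr_gt0// exprn_gt0.
have mev q : measurable (ev q).
  by apply: measurable_hit; exact: measurable_near_lattice.
have := slln_along (measurable_cell P W) (mu_cell P W) mev (@mu_event P W)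
  (@mu_event2 P W) (fun j => @Sh_far (T j)) (fun j => finmap.fset_uniq _) V0 sumV.
apply: filterS => Aw + Awc => /(_ Awc) XV.
apply: (@cvg_log_interpolation _ _ T).
- by move=> x y xy; exact: X_nondecreasing.
- by move=> x; exact: X_ge0.
- by move=> i j ij; rewrite ler_expR lerXn2r ?nnegrE ?(ltW (u0 _))// ler_nat leq_add2r.
- by move=> j; rewrite expR_gt1 exprn_gt0.
- exact: Ty.
- under eq_fun => j.
    rewrite (_ : ln (T j.+1) / ln (T j) = (1 + (u j)^-1) ^+ 2).
      over.
    have uS : u j.+1 = u j + 1 by rewrite natr1.
    by rewrite !lnT uS; have := u0 j; move: (u j) => y y0; field; rewrite gt_eqF.
  suff : (1 + (u j)^-1) ^+ 2 @[j --> \oo] --> (1 + 0 : R) ^+ 2 by rewrite addr0 expr1n.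
  apply: cvg_exprn; apply: cvgD; first exact: cvg_cst.
  by apply/gtr0_cvgV0 => //; apply: nearW => j; exact: u0.
- have VT : (\sum_(q <- Sh (T j)) v q) / ln (T j) @[j --> \oo] --> kappa.
    exact: (cvg_comp _ _ Ty V_asymptotic).
  rewrite -[kappa]mul1r.
  under eq_fun => j.
    rewrite (_ : X (T j) Aw / ln (T j) = (X (T j) Aw / \sum_(q <- Sh (T j)) v q) *
      ((\sum_(q <- Sh (T j)) v q) / ln (T j))).
      over.
    by rewrite mulrA divfK// gt_eqF.
  exact: cvgM.
Unshelve. all: by end_near. Qed.

End almost_sure_count.

Lemma mem_floor_cell (R : realType) (m n : nat) (A : 'M[R]_(m, n)) :
  unit_cell (map_mx intr (map_mx Num.floor A)) A.
Proof. by move=> i j; rewrite !mxE -intrD1; exact: floor_itv. Qed.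

Theorem theorem1p4 (R : realType) (m n : nat) (hm : (0 < m)%N) (hn : (0 < n)%N)
    (b : R) (hb : 0 < b) :
  {ae (lebesgue_mx m n \x lebesgue_mx m 1)%E,
    forall Aw : 'M[R]_(m, n) * 'cV[R]_m,
      (num_solutions Aw.1 Aw.2 b T *
        (b ^+ m * unit_ball_volume m * unit_sphere_area n * ln T)^-1%:E)%E
      @[T --> +oo] --> 1%E}.
Proof.
have [R0 R01 small] := @target_radius_eventually_small R m n b hm hn hb.
(* a countable family of unit cells covering the space *)
pose corner k : 'M[int]_(m, n) * 'cV[int]_m := odflt (0, 0) (unpickle k).
have := ae_foralln (fun k => ae_occurrences_asymptotic hm hn hb R01 small
  (map_mx intr (corner k).1) (map_mx intr (corner k).2)).
apply: filterS => -[A w] /(_ (pickle (map_mx Num.floor A, map_mx Num.floor w))).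
rewrite /corner pickleK /= => /(_ (conj (mem_floor_cell A) (mem_floor_cell w))).
rewrite unit_sphere_areaE; set kappa := b ^+ m * _ * _.
pose X T := occurrences R (@approx_event R m n b)
  (finmap.enum_fset (fset_set (@shell R n R0 T))) (A, w).
move=> XT; have {}XT : X T / ln T @[T --> +oo] --> kappa by [].
 pose C : R := \sum_(x \in solutions b A w (@shell R n 1 R0)) (1 : R).
have k0 : 0 < kappa.
  by rewrite !mulr_gt0 ?exprn_gt0 ?unit_ball_volume_gt0 ?ltr0n.
have lnV : (ln T)^-1 @[T --> +oo] --> (0 : R).
  apply/gtr0_cvgV0.
    by near=> T; rewrite ln_gt0//; near: T; apply: nbhs_pinfty_gt; exact: num_real.
  apply/cvgryPge => a; near=> T.
  have T0 : expR a <= T by near: T; apply: nbhs_pinfty_ge; exact: num_real.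
  by rewrite -[a]expRK ler_ln ?posrE ?expR_gt0// (lt_le_trans (expR_gt0 a)).
have : (C * (ln T)^-1 + X T / ln T) * kappa^-1 @[T --> +oo] --> (C * 0 + kappa) * kappa^-1.
  by apply: cvgMr_tmp; apply: cvgD => //; exact: cvgMl_tmp.
rewrite mulr0 add0r mulfV ?gt_eqF// => lim1.
apply: (@cvg_trans _ (((C * (ln T)^-1 + X T / ln T) * kappa^-1)%:E @[T --> +oo])); last first.
  by apply: cvg_EFin => //; exact: nearW.
apply: near_eq_cvg; near=> T.
rewrite (solutions_count_cat A w R01 _ small); last first.
  by near: T; apply: nbhs_pinfty_ge; exact: num_real.
by rewrite -EFinM -mulrDl [in RHS]invfM -mulrA [(ln T)^-1 * _]mulrC.
Unshelve. all: by end_near. Qed.
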